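(* Let $l:\Omega_T\times[0,T]\times\mathbb{R}\to\mathbb{R}$ satisfy ($H_l$) and let $S$ satisfy ($H_S$) with exponent $p\ge1$. Then there exists a unique solution $(X,A)\in S_G^p(0,T)\times I[0,T]$ to the Skorokhod problem with mean reflection $\mathbb{SP}(l,S)$.
   Context: **$G$-expectation framework.** Fix $T>0$ and $0<\underline{\sigma}^2<\overline{\sigma}^2$; $\Omega_T$ is the space of real-valued continuous functions on $[0,T]$ starting from $0$, with the supremum norm and Borel $\sigma$-algebra $\mathcal{B}(\Omega_T)$; $B$ is the canonical process; $G(a)=\frac12(\overline{\sigma}^2a^+-\underline{\sigma}^2a^-)$. $L_{ip}(\Omega_T)$ is the set of $\varphi(B_{t_1},\dots,B_{t_n})$ with $n\in\mathbb{N}$, $t_i\in[0,T]$, $\varphi$ bounded Lipschitz on $\mathbb{R}^n$. The $G$-expectation of $\xi=\varphi(B_{t_1},\dots,B_{t_n})$, $0=t_0\le t_1<\dots<t_n$, is $\widehat{\mathbb{E}}[\xi]=u_1(0,0)$, where, backwards in $k$, $u_k(t,x;x_1,\dots,x_{k-1})$ is the (viscosity) solution of $\partial_tu_k+G(\partial_x^2u_k)=0$ on $[t_{k-1},t_k)\times\mathbb{R}$ with terminal condition $u_n(t_n,x;x_1,\dots,x_{n-1})=\varphi(x_1,\dots,x_{n-1},x)$ and $u_k(t_k,x;x_1,\dots,x_{k-1})=u_{k+1}(t_k,x;x_1,\dots,x_{k-1},x)$ for $k<n$. $L_G^p(\Omega_T)$ ($p\ge1$) is the completion of $L_{ip}(\Omega_T)$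 under $\|\xi\|_{L_G^p}=(\widehat{\mathbb{E}}|\xi|^p)^{1/p}$. There is a weakly compact set $\mathcal{P}$ of probability measures on $(\Omega_T,\mathcal{B}(\Omega_T))$ with $\widehat{\mathbb{E}}[\xi]=\sup_{\mathsf{P}\in\mathcal{P}}\mathsf{E}^{\mathsf{P}}[\xi]$ for $\xi\in L_G^1(\Omega_T)$; the same formula defines $\widehat{\mathbb{E}}$ for other measurable random variables. A property holds quasi-surely (q.s.) if it holds outside a set $N$ with $\sup_{\mathsf{P}\in\mathcal{P}}\mathsf{P}(N)=0$; random variables that are equal q.s. are identified, and inequalities between random variables are understood q.s. **Process spaces.** $S_G^0(0,T)$ is the set of processes $f(t,B_{t_1\wedge t},\dots,B_{t_n\wedge t})$ with $t_i\in[0,T]$, $f$ bounded Lipschitz on $\mathbb{R}^{n+1}$; $S_G^p(0,T)$ is its completion under $\|\eta\|_{S_G^p}=(\widehat{\mathbb{E}}\sup_{t\in[0,T]}|\eta_t|^p)^{1/p}$. $I[0,T]$ is the set of deterministic continuous nondecreasing functions on $[0,T]$ with initial value $0$. **Assumptions** (dependence on $\omega$ is suppressed). ($H_l$) $l:\Omega_T\times[0,T]\times\mathbb{R}\to\mathbb{R}$ satisfies: (1) $l(t,x)$ is uniformly continuous in $(t,x)$, uniformly in $\omega$; (2) for every $t$, $x\mapsto l(t,x)$ is strictly increasing, q.s.; (3) for every $(t,x)$, $l(t,x)\in L_G^1(\Omega_T)$, and $\widehat{\mathbb{E}}[\lim_{x\uparrow\infty}l(t,x)]>0$; (4) for some $\kappa>0$,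 $|l(t,x)|\le\kappa(1+|x|)$ q.s. for every $(t,x)$. ($H_S$) There exists $p\ge1$ such that $S\in S_G^p(0,T)$, and $\widehat{\mathbb{E}}[l(0,S_0)]\ge0$. **Skorokhod problem with mean reflection.** A solution of $\mathbb{SP}(l,S)$ is a pair $(X,A)\in S_G^p(0,T)\times I[0,T]$ such that for $t\in[0,T]$: (a) $X_t=S_t+A_t$; (b) $\widehat{\mathbb{E}}[l(t,X_t)]\ge0$; (c) $\int_0^T\widehat{\mathbb{E}}[l(t,X_t)]\,dA_t=0$. *)

(* Defs.v *)
From HB Require Import structures.
From mathcomp Require Import all_boot all_order all_algebra.
From mathcomp Require Import all_classical all_reals all_analysis.
Import Order.TTheory GRing.Theory Num.Theory.
Import numFieldNormedType.Exports.

Set Implicit Arguments.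
Unset Strict Implicit.
Unset Printing Implicit Defensive.

Local Open Scope classical_set_scope.
Local Open Scope ring_scope.

Definition clamp (R : realType) (T t : R) : R := Num.max 0 (Num.min t T).

(* A continuous path on [0, T] started at 0 is represented by its unique
   extension to the real line that is constant before 0 and after T. *)
Record Omega (R : realType) (T : R) := MkOmega {
  path_fun :> R -> R;
  path_continuous : continuous path_fun;
  path_start : path_fun 0 = 0;
  path_frozen : forall t, path_fun t = path_fun (clamp T t) }.

Section CanonicalSpace.
Context (R : realType) (T : R).

HB.instance Definition _ := gen_eqMixin (Omega T).
HB.instance Definition _ := gen_choiceMixin (Omega T).

Definition zero_path : Omega T :=
  @MkOmega R T (fun=> 0) (fun=> cvg_cst 0) erefl (fun=> erefl).

HB.instance Definition _ := isPointed.Build (Omega T) zero_path.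

(* The topology of uniform convergence on [0, T], i.e. that of the supremum
   norm. *)
Definition path_unif (w : Omega T) : {uniform` `[0, T] -> R} := path_fun w.

HB.instance Definition _ :=
  Uniform.copy (Omega T) (initial_topology path_unif).

HB.instance Definition _ :=
  Measurable.copy (Omega T) (g_sigma_algebraType (@open (Omega T))).

Definition B (t : R) (w : Omega T) : R := w t.

Definition bounded_continuous : set (Omega T -> R) :=
  [set f | continuous f /\ bounded_fun f].

(* Probability measures on Omega_T with the topology of weak convergence. *)
Definition weak_law : Type :=
  initial_topology
    ((fun Q f => (\int[Q]_w (set_val f w))%R)
      : probability (Omega T) R -> {ptws bounded_continuous -> R}).

HB.instance Definition _ := Topological.on weak_law.

Definition weakly_compact (Ps : set (probability (Omega T) R)) : Prop :=
  compact (Ps : set weak_law).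

(* The upper expectation sup_{Q in Ps} E^Q; it is the G-expectation extended to
   all random variables when Ps satisfies [represents_Gexpectation]. *)
Definition Ehat (Ps : set (probability (Omega T) R)) (xi : Omega T -> \bar R)
    : \bar R :=
  ereal_sup [set \int[Q]_w xi w | Q in Ps]%E.

Definition qs (Ps : set (probability (Omega T) R)) (E : set (Omega T)) : Prop :=
  exists N : set (Omega T),
    [/\ measurable N, ereal_sup [set Q N | Q in Ps] = 0%E & ~` N `<=` E].

End CanonicalSpace.

Section GExpectation.
Context (R : realType) (T sigma_lo sigma_hi : R).

Definition G (a : R) : R :=
  2^-1 * (sigma_hi ^+ 2 * Num.max a 0 - sigma_lo ^+ 2 * Num.max (- a) 0).

Definition dt (psi : R -> R -> R) (t x : R) : R := derive1 (psi^~ x) t.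
Definition dx (psi : R -> R -> R) (t x : R) : R := derive1 (psi t) x.
Definition dxx (psi : R -> R -> R) (t x : R) : R := dx (dx psi) t x.

Definition C12 (psi : R -> R -> R) : Prop :=
  [/\ forall t x, [/\ derivable (psi^~ x) t 1, derivable (psi t) x 1
                    & derivable (dx psi t) x 1],
      continuous (fun z : R * R => psi z.1 z.2),
      continuous (fun z : R * R => dt psi z.1 z.2),
      continuous (fun z : R * R => dx psi z.1 z.2)
    & continuous (fun z : R * R => dxx psi z.1 z.2)].

Definition viscosity_sub (a b : R) (u : R -> R -> R) : Prop :=
  forall psi, C12 psi -> forall t x : R, a <= t < b ->
    (\forall z \near (t, x), a <= z.1 < b ->
       u z.1 z.2 - psi z.1 z.2 <= u t x - psi t x) ->
    0 <= dt psi t x + G (dxx psi t x).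

Definition viscosity_super (a b : R) (u : R -> R -> R) : Prop :=
  forall psi, C12 psi -> forall t x : R, a <= t < b ->
    (\forall z \near (t, x), a <= z.1 < b ->
       u t x - psi t x <= u z.1 z.2 - psi z.1 z.2) ->
    dt psi t x + G (dxx psi t x) <= 0.

(* Viscosity solutions on [a, b) x R of the terminal value problem, with the
   terminal value left free. Boundedness is the growth condition that makes the
   solution unique for bounded terminal data. *)
Definition G_heat_solution (a b : R) (u : R -> R -> R) : Prop :=
  [/\ {within [set z : R * R | a <= z.1 <= b],
         continuous (fun z : R * R => u z.1 z.2)},
      exists M : R, forall t x, a <= t <= b -> `|u t x| <= M,
      viscosity_sub a b u
    & viscosity_super a b u].

Definition bounded_lipschitz (n : nat) (phi : 'rV[R]_n -> R) : Prop :=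
  bounded_fun phi /\ lipschitz phi.

Definition cylinder (n : nat) (ts : n.-tuple R) (phi : 'rV[R]_n -> R)
    (w : Omega T) : R :=
  phi (\row_i B (tnth ts i) w).

Definition Lip : set (Omega T -> R) :=
  [set xi | exists (n : nat) (ts : n.+1.-tuple R) (phi : 'rV[R]_n.+1 -> R),
    [/\ forall i, 0 <= tnth ts i <= T, bounded_lipschitz phi
      & xi = cylinder ts phi]].

(* [u [:: x_1; ...; x_(k-1)]] is the function u_k(., .; x_1, ..., x_(k-1));
   thus k - 1 is the size of the first argument, and the time interval of u_k
   runs from (0 :: ts)`_(k - 1) to ts`_(k - 1). *)
Definition backward_system (n : nat) (ts : n.+1.-tuple R)
    (phi : 'rV[R]_n.+1 -> R) (u : seq R -> R -> R -> R) : Prop :=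
  [/\ forall xs, (size xs <= n)%N ->
        G_heat_solution (0 :: ts)`_(size xs) ts`_(size xs) (u xs),
      forall xs x, size xs = n ->
        u xs ts`_n x = phi (\row_i (rcons xs x)`_i)
    & forall xs x, (size xs < n)%N ->
        u xs ts`_(size xs) x = u (rcons xs x) ts`_(size xs) x].

Definition Gexp_value (xi : Omega T -> R) (v : R) : Prop :=
  exists (n : nat) (ts : n.+1.-tuple R) (phi : 'rV[R]_n.+1 -> R)
         (u : seq R -> R -> R -> R),
    [/\ (forall i, 0 <= tnth ts i <= T) /\ sorted <%R ts,
        bounded_lipschitz phi, xi = cylinder ts phi,
        backward_system ts phi u & v = u [::] 0 0].

Definition Gexpectation (xi : Omega T -> R) : R := get (Gexp_value xi).

(* Asking for the representation on [Lip] is enough: both sides are continuous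
   for the L^1_G norm, so it extends to the completion. *)
Definition represents_Gexpectation (Ps : set (probability (Omega T) R))
    : Prop :=
  forall xi, Lip xi -> (Gexpectation xi)%:E = Ehat Ps (EFin \o xi).

End GExpectation.

Section Spaces.
Context (R : realType) (T : R) (Ps : set (probability (Omega T) R)).

Definition LG_norm (p : R) (xi : Omega T -> R) : \bar R :=
  (Ehat Ps (fun w => (`|xi w| `^ p)%:E) `^ p^-1)%E.

(* The completion of [Lip], realized as its closure in the Borel random
   variables modulo q.s. equality. *)
Definition LG (p : R) : set (Omega T -> R) :=
  [set xi : Omega T -> R | measurable_fun setT xi /\
    exists2 xi_ : (Omega T -> R)^nat, (forall k, Lip (xi_ k)) &
      LG_norm p (fun w => xi w - xi_ k w) @[k --> \oo] --> 0%E].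

(* Processes are functions of time on the whole real line of which only the
   values on [0, T] are relevant. *)
Definition SG0 : set (R -> Omega T -> R) :=
  [set eta | exists (n : nat) (ts : n.-tuple R) (f : 'rV[R]_(1 + n) -> R),
    [/\ forall i, 0 <= tnth ts i <= T, bounded_lipschitz f
      & forall (t : R) w, 0 <= t <= T ->
          eta t w = f (row_mx (const_mx t)
                         (\row_i B (Num.min (tnth ts i) t) w))]].

Definition SG_norm (p : R) (eta : R -> Omega T -> R) : \bar R :=
  (Ehat Ps (fun w => ereal_sup [set ((`|eta t w| `^ p)%R)%:E | t in `[0%R, T]])
    `^ p^-1)%E.

(* The completion of [SG0]. Convergence in [SG_norm] entails q.s. uniform
   convergence along a subsequence, so the elements of the completion are the
   processes with q.s. continuous paths that [SG0] approximates; path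
   continuity also makes the supremum in [SG_norm] measurable up to a polar
   set. *)
Definition SG (p : R) : set (R -> Omega T -> R) :=
  [set eta : R -> Omega T -> R |
    [/\ forall t : R, 0 <= t <= T -> measurable_fun setT (eta t),
        qs Ps [set w | {within `[0, T], continuous (eta^~ w)}]
      & exists2 eta_ : (R -> Omega T -> R)^nat, (forall k, SG0 (eta_ k)) &
          SG_norm p (fun t w => eta t w - eta_ k t w) @[k --> \oo] --> 0%E]].

End Spaces.

Record I0 (R : realType) (T : R) := MkI0 {
  I0_fun :> R -> R;
  I0_continuous : {within `[0, T], continuous I0_fun};
  I0_nondecreasing :
    forall s t : R, 0 <= s -> s <= t -> t <= T -> I0_fun s <= I0_fun t;
  I0_start : I0_fun 0 = 0 }.

Section Stieltjes.
Context (R : realType) (T : R) (A : I0 T).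

(* The Lebesgue-Stieltjes measure of [stopped A] carries the integrals dA over
   [0, T]. *)
Definition stopped (t : R) : R := A (clamp T t).

Let clamp_itv t : 0 <= T -> 0 <= clamp T t <= T.
Proof. by move=> T0; rewrite /clamp le_max ge_max ge_min !lexx T0 orbT. Qed.

Let clamp_nd s t : s <= t -> clamp T s <= clamp T t.
Proof. by move=> st; apply: le_max2 => //; apply: le_min2. Qed.

Let clamp_lt0 t : T < 0 -> clamp T t = 0.
Proof. by move=> T0; apply/max_idPl; rewrite ge_min (ltW T0) orbT. Qed.

Let clamp_continuous : continuous (clamp T).
Proof.
move=> t.
apply: (@continuous_max R R (cst 0) (fun s => Num.min s T)).
  exact: cst_continuous.
by apply: (@continuous_min R R id (cst T)); [|exact: cst_continuous].
Qed.

Lemma stopped_nondecreasing : {homo stopped : s t / s <= t}.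
Proof.
move=> s t st; rewrite /stopped; case: (leP 0 T) => T0; last first.
  by rewrite !clamp_lt0.
have /andP[s0 _] := clamp_itv s T0; have /andP[_ tT] := clamp_itv t T0.
by apply: I0_nondecreasing => //; exact: clamp_nd.
Qed.

Lemma stopped_right_continuous : right_continuous stopped.
Proof.
apply: right_continuousW => t; case: (leP 0 T) => T0; last first.
  rewrite (_ : stopped = cst (A 0)); first exact: cvg_cst.
  by apply/funext => s; rewrite /stopped clamp_lt0.
have clampP s : `[0, T]%classic (clamp T s).
  by rewrite /= in_itv/=; exact: clamp_itv.
have /subspace_continuousP/(_ _ (clampP t)) Ac := @I0_continuous R T A.
apply: (cvg_comp (clamp T) A _ Ac) => U WU.
apply: (@filterS _ (nbhs t) _ _ _ _ (@clamp_continuous t _ WU)) => s.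
by apply; exact: clampP.
Qed.

HB.instance Definition _ :=
  isCumulative.Build R _ R stopped
    stopped_nondecreasing stopped_right_continuous.

End Stieltjes.

Section SkorokhodProblem.
Context (R : realType) (T : R) (Ps : set (probability (Omega T) R)).
Implicit Types (l : Omega T -> R -> R -> R) (S X : R -> Omega T -> R).

Definition Hl l : Prop :=
  [/\ forall e : R, 0 < e -> exists2 d : R, 0 < d &
        forall w (s t x y : R), 0 <= s <= T -> 0 <= t <= T ->
          `|s - t| < d -> `|x - y| < d -> `|l w s x - l w t y| < e,
      forall t : R, 0 <= t <= T ->
        qs Ps [set w | {homo l w t : x y / x < y}],
      forall t : R, 0 <= t <= T ->
        (forall x, LG Ps 1 (fun w => l w t x)) /\
        (0 < Ehat Ps (fun w => lim ((l w t x)%:E @[x --> +oo%R])))%E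
    & exists2 kappa : R, 0 < kappa &
        forall t x : R, 0 <= t <= T ->
          qs Ps [set w | `|l w t x| <= kappa * (1 + `|x|)]].

Definition HS l (p : R) S : Prop :=
  [/\ 1 <= p, SG Ps p S & (0 <= Ehat Ps (fun w => (l w 0 (S 0 w))%:E))%E].

Definition SP l (p : R) S X (A : I0 T) : Prop :=
  [/\ SG Ps p X,
      forall t : R, 0 <= t <= T -> qs Ps [set w | X t w = S t w + A t],
      forall t : R, 0 <= t <= T ->
        (0 <= Ehat Ps (fun w => (l w t (X t w))%:E))%E
    & (\int[lebesgue_stieltjes_measure (stopped A)]_(t in `[0%R, T])
         Ehat Ps (fun w => (l w t (X t w))%:E) = 0)%E].

End SkorokhodProblem.

(* Main.v *)
(** The constraint function H(t, a) = E^[l(t, S_t + a)] is jointly continuous,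
    strictly increasing in a, eventually positive, and H(0, 0) >= 0. Given this,
    the problem is deterministic: A_t = inf {a >= 0 : H(s, a) >= 0 for s <= t}
    is continuous and increases only when H(t, A_t) = 0, and two solutions A, A'
    agree because a time r at which A' first reaches a value exceeding A has
    H(r, A'_r) > 0, so that A' is constant just before r.
    The properties of H rest on the quasi-continuity of l(t, S_t + a), that is,
    its approximation by bounded continuous functions in L^1, uniformly over Ps:
    by weak compactness the upper expectation is then attained, which gives
    strictness, and E^|S_t - S_s| tends to 0 as s tends to t. *)

From mathcomp Require Import all_boot all_order all_algebra.
From mathcomp Require Import all_classical all_reals all_analysis.
From mathcomp Require Import measurable_realfun lra ring.
Require Import Defs.
Import Order.TTheory GRing.Theory Num.Theory.
Import numFieldNormedType.Exports.
Set Implicit Arguments.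
Unset Strict Implicit.
Unset Printing Implicit Defensive.
Local Open Scope classical_set_scope.
Local Open Scope ring_scope.

(** Lower integrals occur because the supremum over time in the norm of $S_G^p$ need not be
    measurable; estimates on it go through measurable minorants and pointwise bounds. The obstacle
    that shapes the rest is that ($H_l$) places $l(t,x)$ in $L_G^1$ for deterministic $x$, whereas
    $H$ evaluates $l$ at the random point $S_t+a$, and that $l$ is only uniformly continuous in $x$.
    Interpolating $l(t,\cdot)$ linearly between deterministic nodes turns the composition with a
    continuous $Y$ into a finite sum of products of a quasi-continuous variable and a bounded
    continuous function of the path. The missing Lipschitz bound is replaced by the fact that a
    uniform modulus of continuity lets increments grow at most affinely with the distance, which is
    enough for $L^1$ estimates. *)

(* For nonnegative functions that need not be measurable, MathComp's integral
   is the lower integral; it is still monotone. *)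
Section lower_integral.
Local Open Scope ereal_scope.
Import HBNNSimple.
Context d (T : measurableType d) (R : realType).
Variable mu : {measure set T -> \bar R}.
Implicit Types f g : T -> \bar R.

Lemma ge0_lower_integral_le f g : (forall x, 0 <= f x) ->
  (forall x, f x <= g x) -> \int[mu]_x f x <= \int[mu]_x g x.
Proof.
move=> f0 fg; have g0 x : 0 <= g x := le_trans (f0 x) (fg x).
rewrite !ge0_integralTE//; apply: ereal_sup_le => _ [h /= hf <-].
by exists h => // x; exact: le_trans (fg x).
Qed.

(** Simple functions are among the real measurable minorants, so a bound on the latter bounds the
    supremum that defines the integral. Later estimates thereby reach measurable functions, where
    linearity is available. *)
Lemma lower_integral_lub f (y : \bar R) : (forall x, 0 <= f x) ->
  (forall h : T -> R, measurable_fun setT h -> (forall x, 0 <= h x)%R ->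
     (forall x, (h x)%:E <= f x) -> \int[mu]_x (h x)%:E <= y) ->
  \int[mu]_x f x <= y.
Proof.
move=> f0 hy; rewrite ge0_integralTE//; apply: ge_ereal_sup => _ [h /= hf <-].
have := hy h; rewrite (integral_nnsfun _ measurableT) patch_setT; apply => //.
Qed.

(** A measurable minorant of [f], set to 0 on [N], becomes a minorant of [g] and loses no mass. *)
Lemma ge0_lower_integral_le_off (N : set T) f g :
  measurable N -> mu N = 0 -> (forall x, 0 <= f x) -> (forall x, 0 <= g x) ->
  (forall x, ~ N x -> f x <= g x) -> \int[mu]_x f x <= \int[mu]_x g x.
Proof.
move=> mN N0 f0 g0 fg; apply: lower_integral_lub => // h mh h0 hf.
rewrite (ge0_negligible_integral mN)//; last 2 first.
- exact/measurable_EFinP.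
- by move=> x _; rewrite lee_fin.
rewrite setTD integral_mkcond; apply: ge0_lower_integral_le => x.
  by rewrite patchE; case: ifPn => // _; rewrite lee_fin.
by rewrite patchE; case: ifPn => // /[1!inE] Nx; exact: le_trans (fg _ Nx).
Qed.

Lemma eq_lower_integral_off (N : set T) f g :
  measurable N -> mu N = 0 -> (forall x, ~ N x -> f x = g x) ->
  \int[mu]_x f x = \int[mu]_x g x.
Proof.
move=> mN N0 fg; rewrite [LHS]integralE [RHS]integralE.
congr (_ - _); apply/eqP; rewrite eq_le; apply/andP; split;
  apply: (ge0_lower_integral_le_off mN N0) => // x Nx;
  by rewrite ?funeposE ?funenegE fg.
Qed.

End lower_integral.

(** Lower integrals are not additive in general, so the argument runs on minorants: if [h] is one of
    [f], then [Num.max 0 (K^-1 * h - c)] is a measurable minorant of [g], and for it the constant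
    splits off because [Q] has mass 1. *)
Lemma lower_integral_le_affine d (T : measurableType d) (R : realType)
    (Q : probability T R) (f g : T -> \bar R) (K c : R) :
  0 < K -> 0 <= c -> (forall x, 0 <= f x)%E -> (forall x, 0 <= g x)%E ->
  (forall x, f x <= K%:E * (g x + c%:E))%E ->
  (\int[Q]_x f x <= K%:E * (\int[Q]_x g x + c%:E))%E.
Proof.
move=> K0 c0 f0 g0 fg; apply: lower_integral_lub => // h mh h0 hf.
pose u x := Num.max 0 (K^-1 * h x - c).
have mu_ : measurable_fun setT u.
  apply: measurable_maxr => //; apply: measurable_funB => //.
  by apply: measurable_funM.
have u0 x : 0 <= u x by rewrite le_max lexx.
have ug x : ((u x)%:E <= g x)%E.
  rewrite EFin_max ge_max g0/= EFinB leeBlDr//.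
  by rewrite EFinM lee_pdivrMl// (le_trans (hf x)).
apply: (@le_trans _ _ (K%:E * (\int[Q]_x (u x)%:E + c%:E))%E); last first.
  rewrite lee_pmul2l// leeD2r//; apply: ge0_lower_integral_le => x //.
  by rewrite lee_fin.
have -> : (\int[Q]_x (u x)%:E + c%:E = \int[Q]_x ((u x)%:E + c%:E))%E.
  rewrite ge0_integralD//.
  - by congr (_ + _)%E; rewrite (integral_cst Q measurableT c%:E) [X in (_ * X)%E]probability_setT mule1.
  - by move=> x _; rewrite lee_fin.
  - exact/measurable_EFinP.
rewrite -ge0_integralZl_EFin//; last 3 first.
- by move=> x _; rewrite -EFinD lee_fin addr_ge0.
- by apply/measurable_EFinP; exact: measurable_funD.
- exact: ltW.
apply: ge0_le_integral => //.
- by move=> x _; rewrite lee_fin.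
- exact/measurable_EFinP.
- by apply/measurable_EFinP; apply: measurable_funM => //; exact: measurable_funD.
- move=> x _; rewrite -EFinD -EFinM lee_fin -ler_pdivrMl// -lerBlDr.
  by rewrite le_max lexx orbT.
Qed.

(** * Path space and the weak topology on its probability measures *)

Section path_space.
Context (R : realType) (T : R).
Hypothesis T_gt0 : 0 < T.

Lemma clamp_in (t : R) : 0 <= clamp T t <= T.
Proof. by rewrite /clamp le_max ge_max ge_min !lexx (ltW T_gt0) orbT. Qed.

Lemma clamp_id (t : R) : 0 <= t <= T -> clamp T t = t.
Proof. by case/andP=> t0 tT; rewrite /clamp; move/min_idPl: tT => ->; exact/max_idPr. Qed.

Lemma clamp_lip (s t : R) : `|clamp T s - clamp T t| <= `|s - t|.
Proof.
have T0 := T_gt0; have st := ler_norm (s - t).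
have ts := ler_norm (t - s); rewrite distrC in ts.
by rewrite /clamp ler_norml; case: (leP s T) => ?; case: (leP t T) => ?;
  case: (leP 0 s) => ?; case: (leP 0 t) => ?; case: (leP 0 T) => ?; lra.
Qed.

(** The uniformity compares paths on [[0, T]] only; frozenness carries the bound to all times. *)
Lemma near_path (w : Omega T) (e : R) : 0 < e ->
  \forall w' \near w, forall s, `|w s - (w' : Omega T) s| < e.
Proof.
move=> e0.
have : nbhs (path_unif w) [set h : {uniform` `[0, T] -> R} |
    forall y, y \in `[0, T]%R -> ball (w y) e (h y)].
  apply/uniform_nbhs; exists [set xy | ball xy.1 e xy.2]; split => //.
  by apply: entourage_ball (PosNum e0).
move=> /(@initial_continuous _ _ (@path_unif R T) w) ww.
apply: (@filterS _ (nbhs w) _ _ _ _ ww) => w' ww' s.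
rewrite (path_frozen w) (path_frozen w').
by have := ww' (clamp T s); apply; rewrite in_itv/= clamp_in.
Qed.

Lemma continuous_measurable_Omega (f : Omega T -> R) :
  continuous f -> measurable_fun setT f.
Proof.
move=> /continuousP cf; apply: (measurability _ (RGenOpens.measurableE R)).
move=> _ [_ [a [b ->]] <-]; rewrite setTI; apply: sub_sigma_algebra.
by apply: cf; exact: interval_open.
Qed.

Lemma bounded_continuousP (f : Omega T -> R) (M : R) :
  continuous f -> (forall w, `|f w| <= M) -> bounded_continuous f.
Proof.
move=> cf fM; split => //; exists M; split; first exact: num_real.
by move=> x Mx w _; apply: le_trans (fM w) (ltW Mx).
Qed.

(** The weak topology is initial for the pairings with bounded continuous functions; integrating [f]
    is the defining map followed by a coordinate projection. *)
Lemma weak_near (f : Omega T -> R) (M : R) (Q : weak_law T) (e : R) :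
  continuous f -> (forall w, `|f w| <= M) -> 0 < e ->
  \forall Q' \near Q, `| \int[Q : probability (Omega T) R]_w f w
                       - \int[Q' : probability (Omega T) R]_w f w | < e.
Proof.
move=> cf fM e0.
pose F : @bounded_continuous R T := SigSub (mem_set (bounded_continuousP cf fM)).
pose phi (Q : probability (Omega T) R) : {ptws @bounded_continuous R T -> R} :=
  fun f => \int[Q]_w (set_val f w).
have cphi : {for Q, continuous (phi : initial_topology phi -> _)} :=
  @initial_continuous _ _ phi Q.
have cF := @proj_continuous _ (fun=> R) F (phi Q).
have /cvgr_dist_lt/(_ _ e0) := cvg_comp _ _ cphi cF.
move=> H; have {}H := H (fmap_filter _ (nbhs_filter Q)).
exact: H.
Qed.

End path_space.

(** * Quasi-continuous random variables *)

Section quasi_continuity.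
Context (R : realType) (T : R) (Ps : set (probability (Omega T) R)).
Hypothesis T_gt0 : 0 < T.
Implicit Types (f g h xi : Omega T -> R) (Q : probability (Omega T) R).

(** This bounds the upper expectation of [|f - g|], stated measure by measure so that classical
    integral estimates apply directly. *)
Definition L1close (e : R) f g := forall Q, Ps Q ->
  (\int[Q]_w (`|f w - g w|)%:E <= e%:E)%E.

(** Continuous approximants are more flexible than the cylinder functions behind [LG]: sums,
    products and compositions stay admissible without being rewritten in finitely many coordinates
    of the path. *)
Definition qcont xi := measurable_fun setT xi /\
  forall e, 0 < e -> exists f, [/\ continuous f,
    exists M, forall w, `|f w| <= M & L1close e xi f].

Lemma measurable_dist f g : measurable_fun setT f -> measurable_fun setT g ->
  measurable_fun setT (fun w => (`|f w - g w|)%:E).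
Proof.
move=> mf mg; apply/measurable_EFinP; apply: measurableT_comp => //.
exact: measurable_funB.
Qed.

Lemma L1close_pointwise e f g : (forall w, `|f w - g w| <= e) -> L1close e f g.
Proof.
move=> fg Q _; have -> : e%:E = (\int[Q]_w (cst e%:E) w)%E.
  by rewrite (integral_cst Q measurableT e%:E) [X in (_ * X)%E]probability_setT mule1.
by apply: ge0_lower_integral_le => w; rewrite lee_fin.
Qed.

Lemma L1closeC e f g : L1close e f g -> L1close e g f.
Proof. by move=> fg Q PQ; under eq_integral do rewrite distrC; exact: fg. Qed.

Lemma L1close_trans g e1 e2 f h :
  measurable_fun setT f -> measurable_fun setT g -> measurable_fun setT h ->
  L1close e1 f g -> L1close e2 g h -> L1close (e1 + e2) f h.
Proof.
move=> mf mg mh fg gh Q PQ; rewrite EFinD.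
apply: le_trans (leeD (fg _ PQ) (gh _ PQ)).
rewrite -ge0_integralD//; try exact: measurable_dist.
by apply: ge0_lower_integral_le => w; rewrite -?EFinD lee_fin// ler_distD.
Qed.

Lemma L1close_le e e' f g : e <= e' -> L1close e f g -> L1close e' f g.
Proof. by move=> ee' fg Q PQ; apply: le_trans (fg _ PQ) _; rewrite lee_fin. Qed.

Lemma L1closeD e1 e2 f1 g1 f2 g2 :
  measurable_fun setT f1 -> measurable_fun setT g1 ->
  measurable_fun setT f2 -> measurable_fun setT g2 ->
  L1close e1 f1 g1 -> L1close e2 f2 g2 ->
  L1close (e1 + e2) (f1 \+ f2) (g1 \+ g2).
Proof.
move=> mf1 mg1 mf2 mg2 h1 h2 Q PQ; rewrite EFinD.
apply: le_trans (leeD (h1 _ PQ) (h2 _ PQ)).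
rewrite -ge0_integralD//; try exact: measurable_dist.
apply: ge0_lower_integral_le => w; rewrite -?EFinD lee_fin//=.
by rewrite opprD addrACA ler_normD.
Qed.

Lemma L1closeM (M : R) e f1 f2 g : 0 <= M -> measurable_fun setT f1 ->
  measurable_fun setT f2 -> (forall w, `|g w| <= M) ->
  L1close e f1 f2 -> L1close (M * e) (g \* f1) (g \* f2).
Proof.
move=> M0 mf1 mf2 gM h Q PQ; rewrite EFinM.
apply: (@le_trans _ _ (M%:E * \int[Q]_w (`|f1 w - f2 w|)%:E)%E); last first.
  by apply: lee_wpmul2l; [rewrite lee_fin|exact: h].
rewrite -ge0_integralZl_EFin//; last exact: measurable_dist.
apply: ge0_lower_integral_le => w; rewrite -?EFinM lee_fin//=.
by rewrite -mulrBr normrM ler_wpM2r.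
Qed.

Lemma bounded_integrable f (M : R) Q : measurable_fun setT f ->
  (forall w, `|f w| <= M) -> Q.-integrable setT (EFin \o f).
Proof.
move=> mf fM; apply: measurable_bounded_integrable => //.
  by rewrite [X in (X < _)%E]probability_setT ltry.
exists M; split; first exact: num_real.
by move=> x Mx w _; apply: le_trans (fM w) (ltW Mx).
Qed.

Lemma integrable_dist f g (e : R) Q : measurable_fun setT f ->
  Q.-integrable setT (EFin \o g) ->
  (\int[Q]_w (`|f w - g w|)%:E <= e%:E)%E -> Q.-integrable setT (EFin \o f).
Proof.
move=> mf ig fg.
have mg : measurable_fun setT g by apply/measurable_EFinP; exact: measurable_int ig.
have ifg : Q.-integrable setT (EFin \o (f \- g)).
  apply/integrableP; split; first by apply/measurable_EFinP; exact: measurable_funB.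
  by apply: le_lt_trans fg _; rewrite ltry.
rewrite (_ : EFin \o f = (EFin \o (f \- g)%R) \+ (EFin \o g))%E.
  exact: integrableD.
by apply/funext => w /=; rewrite -EFinD subrK.
Qed.

Lemma qcont_integrable xi Q : Ps Q -> qcont xi -> Q.-integrable setT (EFin \o xi).
Proof.
move=> PQ [mxi /(_ 1 ltr01)[f [cf [M fM] xf]]].
apply: (integrable_dist mxi _ (xf _ PQ)); apply: (bounded_integrable Q _ fM).
exact: continuous_measurable_Omega.
Qed.

Lemma mean_dist f g (e : R) Q : Q.-integrable setT (EFin \o f) ->
  Q.-integrable setT (EFin \o g) ->
  (\int[Q]_w (`|f w - g w|)%:E <= e%:E)%E ->
  `|\int[Q]_w f w - \int[Q]_w g w| <= e.
Proof.
move=> jf jg fg; rewrite -RintegralB//.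
rewrite -lee_fin; apply: le_trans fg.
have jfg : Q.-integrable setT (EFin \o (f \- g)).
  by have := integrableB measurableT jf jg.
rewrite EFin_normr_Rintegral//.
exact: le_abse_integral (measurable_int _ jfg).
Qed.

Lemma mean_close e f g Q : Ps Q -> Q.-integrable setT (EFin \o f) ->
  Q.-integrable setT (EFin \o g) -> L1close e f g ->
  `|\int[Q]_w f w - \int[Q]_w g w| <= e.
Proof. by move=> PQ jf jg fg; apply: mean_dist => //; exact: fg. Qed.

Lemma qcont_continuous f (M : R) :
  continuous f -> (forall w, `|f w| <= M) -> qcont f.
Proof.
move=> cf fM; split; first exact: continuous_measurable_Omega.
move=> e e0; exists f; split => //; first by exists M.
by apply: L1close_pointwise => w; rewrite subrr normr0 ltW.
Qed.

Lemma qcont_approx f : measurable_fun setT f ->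
  (forall e, 0 < e -> exists2 g, qcont g & L1close e f g) -> qcont f.
Proof.
move=> mf fg; split => // e e0; have e2 : 0 < e / 2 by rewrite divr_gt0.
have [g [mg qg] cfg] := fg _ e2; have [h [ch hM gh]] := qg _ e2.
exists h; split => //; rewrite (splitr e).
by apply: L1close_trans cfg gh => //; exact: continuous_measurable_Omega.
Qed.

Lemma qcontD f g : qcont f -> qcont g -> qcont (f \+ g).
Proof.
move=> [mf qf] [mg qg]; split; first exact: measurable_funD.
move=> e e0; have e2 : 0 < e / 2 by rewrite divr_gt0.
have [f' [cf' [M fM] ff']] := qf _ e2; have [g' [cg' [N gN] gg']] := qg _ e2.
exists (f' \+ g'); split.
- by move=> w; apply: continuousD; [exact: cf'|exact: cg'].
- exists (M + N) => w /=; rewrite (le_trans (ler_normD _ _))//.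
  by rewrite lerD.
- by rewrite (splitr e); apply: L1closeD => //; exact: continuous_measurable_Omega.
Qed.

Lemma qcontM (M : R) f g : continuous g -> (forall w, `|g w| <= M) ->
  qcont f -> qcont (g \* f).
Proof.
move=> cg gM [mf qf]; have M0 : 0 <= M by apply: le_trans (gM point).
have mg := continuous_measurable_Omega cg.
split; first exact: measurable_funM.
(* [M + 1] because [M] may vanish. *)
move=> e e0; have eM : 0 < e / (M + 1) by rewrite divr_gt0// ltr_wpDl.
have [h [ch [N hN] fh]] := qf _ eM; exists (g \* h); split.
- by move=> w; apply: continuousM; [exact: cg|exact: ch].
- by exists (M * N) => w /=; rewrite normrM ler_pM.
- have mh := continuous_measurable_Omega ch.
  apply: L1close_le (L1closeM M0 mf mh gM fh).
  by rewrite mulrCA ger_pMr// ler_pdivrMr ?mul1r ?lerDl ?ltr_wpDl// .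
Qed.

Lemma qcontB f g : qcont f -> qcont g -> qcont (f \- g).
Proof.
move=> qf qg; rewrite (_ : f \- g = f \+ (cst (-1) \* g)).
  apply: qcontD => //; apply: (@qcontM 1) => //; first exact: cst_continuous.
  by move=> w; rewrite normrN1.
by apply/funext => w /=; rewrite mulN1r.
Qed.

End quasi_continuity.

(** * Upper expectation of quasi-continuous variables *)

Section upper_expectation.
Context (R : realType) (T : R) (Ps : set (probability (Omega T) R)).
Hypotheses (T_gt0 : 0 < T) (Ps_compact : weakly_compact Ps) (Ps0 : Ps !=set0).
Implicit Types (f g xi : Omega T -> R) (Q : probability (Omega T) R).

Definition upper xi : R := fine (Ehat Ps (EFin \o xi)).

Lemma mean_EFin f Q : Q.-integrable setT (EFin \o f) ->
  (\int[Q]_w (f w)%:E)%E = (\int[Q]_w f w)%:E.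
Proof. by move=> jf; rewrite fineK//; exact: integrable_fin_num. Qed.

(** On [Ps] the map sending [Q] to the mean of [xi] is a uniform limit of weakly continuous maps.
    The neighbourhood is restricted to [Ps] because [f] approximates [xi] under these measures
    only. *)
Lemma qcont_mean_near xi Q (e : R) : Ps Q -> qcont Ps xi -> 0 < e ->
  \forall Q' \near (Q : weak_law T), Ps Q' ->
  `|\int[Q]_w xi w - \int[Q' : probability (Omega T) R]_w xi w| < e.
Proof.
move=> PQ qxi e0; have e3 : 0 < e / 3 by rewrite divr_gt0.
have [mxi /(_ _ e3)[f [cf [M fM] xf]]] := qxi.
have mf := continuous_measurable_Omega cf.
have := weak_near (Q : weak_law T) cf fM e3.
apply: filterS => Q' ff PQ'.
have i1 := mean_close PQ (qcont_integrable PQ qxi) (bounded_integrable Q mf fM) xf.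
have i2 := mean_close PQ' (qcont_integrable PQ' qxi) (bounded_integrable Q' mf fM) xf.
rewrite distrC in i2.
rewrite [e](_ : _ = e / 3 + e / 3 + e / 3); last by field.
apply: le_lt_trans (ler_distD (\int[Q']_w f w) _ _) _.
apply: ltr_leD => //; apply: le_lt_trans (ler_distD (\int[Q]_w f w) _ _) _.
exact: ler_ltD.
Qed.

Lemma upper_attained xi : qcont Ps xi -> exists2 Q, Ps Q &
  (forall Q', Ps Q' -> \int[Q']_w xi w <= \int[Q]_w xi w) /\
  Ehat Ps (EFin \o xi) = (\int[Q]_w xi w)%:E.
Proof.
move=> qxi.
have cont : {within (Ps : set (weak_law T)), continuous
    (fun Q : weak_law T => \int[Q : probability (Omega T) R]_w xi w)}.
  apply/subspace_continuousP => Q PQ; apply/cvgrPdist_lt => e e0.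
  by have := qcont_mean_near PQ qxi e0; rewrite near_withinE.
have [Q + Qmax] := @compact_EVT_max (weak_law T) R _ Ps Ps0 Ps_compact cont.
rewrite inE => PQ; have {}Qmax Q' : Ps Q' -> \int[Q']_w xi w <= \int[Q]_w xi w.
  by move=> PQ'; apply: Qmax; rewrite inE.
exists Q => //; split => //; apply/eqP; rewrite eq_le; apply/andP; split.
  apply: ge_ereal_sup => _ [Q' PQ' <-].
  rewrite mean_EFin; first by rewrite lee_fin Qmax.
  exact: qcont_integrable qxi.
apply: ereal_sup_ubound; exists Q => //.
rewrite mean_EFin//; exact: qcont_integrable qxi.
Qed.

Lemma EhatE xi : qcont Ps xi -> Ehat Ps (EFin \o xi) = (upper xi)%:E.
Proof. by rewrite /upper => /upper_attained[Q _ [_ ->]]. Qed.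

Lemma mean_le_upper xi Q : Ps Q -> qcont Ps xi -> \int[Q]_w xi w <= upper xi.
Proof.
by move=> PQ qxi; rewrite /upper; have [Q0 _ [+ ->]] := upper_attained qxi; exact.
Qed.

Lemma upper_close (e : R) f g : qcont Ps f -> qcont Ps g -> L1close Ps e f g ->
  `|upper f - upper g| <= e.
Proof.
have half f' g' : qcont Ps f' -> qcont Ps g' -> L1close Ps e f' g' ->
    upper f' <= upper g' + e.
  move=> qf qg fg; rewrite {1}/upper; have [Q PQ [_ ->]] := upper_attained qf.
  rewrite /= -lerBlDl.
  have := mean_close PQ (qcont_integrable PQ qf) (qcont_integrable PQ qg) fg.
  have := mean_le_upper PQ qg; rewrite ler_norml; lra.
move=> qf qg fg; rewrite ler_norml.
have := half _ _ qf qg fg; have := half _ _ qg qf (L1closeC fg); lra.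
Qed.

(** Taking suprema would weaken the inequality. Under a measure [Q] that is optimal for [f], the
    mean of [g] strictly exceeds [upper f], and it is at most [upper g]. *)
Lemma upper_lt f g : qcont Ps f -> qcont Ps g ->
  qs Ps [set w | f w < g w] -> upper f < upper g.
Proof.
move=> qf qg [N [mN PsN Nfg]]; rewrite {1}/upper.
have [Q PQ [_ -> /=]] := upper_attained qf.
apply: lt_le_trans (mean_le_upper PQ qg).
have jf := qcont_integrable PQ qf; have jg := qcont_integrable PQ qg.
have QN0 : Q N = 0%E.
  apply/eqP; rewrite eq_le measure_ge0 andbT -PsN.
  by apply: ereal_sup_ubound; exists Q.
have jgf : Q.-integrable setT (EFin \o (g \- f)).
  by have := integrableB measurableT jg jf.
rewrite -subr_gt0 -RintegralB// lt_neqAle; apply/andP; split; last first.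
  rewrite -lee_fin -mean_EFin//.
  have -> : (\int[Q]_w (g w - f w)%:E = \int[Q]_w (Num.max 0 (g w - f w))%:E)%E.
    apply: (eq_lower_integral_off mN QN0) => w Nw.
    by congr (_%:E); apply/esym/max_idPr; rewrite subr_ge0 ltW// Nfg.
  by apply: integral_ge0 => w _; rewrite lee_fin le_max lexx.
apply/eqP => /esym int0.
have abs0 : (\int[Q]_w `|(g w - f w)%:E| = 0)%E.
  rewrite -[RHS]/(0%:E) -int0 -mean_EFin//.
  apply: (eq_lower_integral_off mN QN0) => w Nw.
  by rewrite abse_EFin ger0_norm// subr_ge0 ltW// Nfg.
have /(ae_eq_integral_abs Q measurableT (measurable_int _ jgf))[N' [mN' QN' sub]] := abs0.
(* Off [N] the difference is positive and off [N'] it vanishes, so the two null sets cover the whole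
   space, which has mass 1. *)
have : (Q setT <= Q (N `|` N'))%E.
  apply: le_measure; rewrite ?inE//; first exact: measurableU.
  move=> w _; have [Nw|Nw] := pselect (N w); first by left.
  right; apply: sub => /= /(_ Logic.I) /eqP.
  by rewrite eqe subr_eq0 gt_eqF// Nfg.
have -> : Q (N `|` N') = 0%E by exact: null_set_setU.
by rewrite [X in (X <= _)%E]probability_setT lee_fin ler10.
Qed.

End upper_expectation.


(** * Piecewise linear interpolation and moduli of continuity *)

Section interpolation.
Context (R : realType).
Implicit Types (g : R -> R) (x y z d e : R) (n : nat).

Definition ramp z : R := Num.max 0 (Num.min z 1).

Lemma ramp_itv z : 0 <= ramp z <= 1.
Proof. by rewrite /ramp le_max lexx/= ge_max ler01 ge_min lexx orbT. Qed.

Lemma ramp_le0 z : z <= 0 -> ramp z = 0.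
Proof. by move=> z0; apply/max_idPl; rewrite ge_min z0. Qed.

Lemma ramp_ge1 z : 1 <= z -> ramp z = 1.
Proof. by move=> z1; rewrite /ramp (min_idPr z1); exact/max_idPr. Qed.

Lemma ramp_lip y z : `|ramp y - ramp z| <= `|y - z|.
Proof.
have yz := ler_norm (y - z).
have zy := ler_norm (z - y); rewrite distrC in zy.
by rewrite /ramp ler_norml; case: (leP y 1) => ?; case: (leP z 1) => ?;
  case: (leP 0 y) => ?; case: (leP 0 z) => ?; case: (leP 0 (1 : R)) => ?; lra.
Qed.

(* The piecewise linear interpolation of g at the nodes x + k d, k <= n,
   constant outside of the range of the nodes. *)
Fixpoint interp n g x d y : R :=
  if n is m.+1 then interp m g x d y +
    ramp (d^-1 * (y - (x + m%:R * d))) *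
      (g (x + m.+1%:R * d) - g (x + m%:R * d))
  else g x.

Lemma interp_right n g x d y : 0 < d -> x + n%:R * d <= y ->
  interp n g x d y = g (x + n%:R * d).
Proof.
move=> d0; elim: n => [|n IHn] /=; first by rewrite mul0r addr0.
move=> yn; rewrite IHn; last first.
  by apply: le_trans yn; rewrite lerD2l ler_pM2r// ler_nat.
rewrite ramp_ge1; first by ring.
rewrite -ler_pdivrMl ?invr_gt0// invrK mulr1.
by move: yn; rewrite -natr1; lra.
Qed.

(** In the cell of [y] the interpolant is a convex combination of values of [g] at two nodes, both
    within [d] of [y]. *)
Lemma interp_close n g x d e y : 0 < d ->
  (forall y z, `|y - z| <= d -> `|g y - g z| <= e) ->
  x <= y <= x + n%:R * d -> `|interp n g x d y - g y| <= e.
Proof.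
move=> d0 ge /andP[xy]; elim: n => [|n IHn] /= yn.
  by apply: ge; move: yn; rewrite mul0r ler_norml; lra.
case: (leP y (x + n%:R * d)) => yn'.
  rewrite ramp_le0 ?mul0r ?addr0; first exact: IHn.
  by rewrite pmulr_rle0 ?invr_gt0// subr_le0.
rewrite interp_right ?(ltW yn')//; set r := ramp _.
have /andP[r0 r1] : 0 <= r <= 1 := ramp_itv _.
have g1 : `|g (x + n%:R * d) - g y| <= e.
  by apply: ge; move: yn yn'; rewrite -natr1 ler_norml; lra.
have g2 : `|g (x + n.+1%:R * d) - g y| <= e.
  by apply: ge; move: yn yn'; rewrite -natr1 ler_norml; lra.
set u := g (x + n%:R * d) in g1 *; set v := g (x + n.+1%:R * d) in g2 *.
have -> : u + r * (v - u) - g y = (1 - r) * (u - g y) + r * (v - g y) by ring.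
apply: le_trans (ler_normD _ _) _; rewrite !normrM (ger0_norm r0) ger0_norm ?subr_ge0//.
rewrite [e](_ : _ = (1 - r) * e + r * e); last by ring.
by apply: lerD; apply: ler_wpM2l => //; rewrite subr_ge0.
Qed.

Lemma interp_lip n g x d : 0 < d ->
  exists2 C, 0 <= C & forall y z, `|interp n g x d y - interp n g x d z| <= C * `|y - z|.
Proof.
move=> d0; elim: n => [|n [C C0 IHn]] /=.
  by exists 0 => // y z; rewrite subrr normr0 mul0r.
set b := g _ - g _; exists (C + d^-1 * `|b|).
  by rewrite addr_ge0// mulr_ge0// invr_ge0 ltW.
move=> y z; set ry := ramp _; set rz := ramp _.
have -> : forall u v, u + ry * b - (v + rz * b) = (u - v) + (ry - rz) * b.
  by move=> u v; ring.
rewrite [leRHS]mulrDl; apply: le_trans (ler_normD _ _) _; apply: lerD => //.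
rewrite normrM mulrAC; apply: ler_wpM2r => //.
apply: le_trans (ramp_lip _ _) _; rewrite -mulrBr normrM ger0_norm ?invr_ge0 ?(ltW d0)//.
by apply: ler_wpM2l; [rewrite invr_ge0 ltW|rewrite opprB addrA subrK].
Qed.

Lemma interp_bounded n g x d : exists M, forall y, `|interp n g x d y| <= M.
Proof.
elim: n => [|n [M IHn]] /=; first by exists `|g x|.
set b := g _ - g _; exists (M + `|b|) => y.
apply: le_trans (ler_normD _ _) _; apply: lerD => //.
rewrite normrM ler_piMl//; have /andP[r0 r1] := ramp_itv (d^-1 * (y - (x + n%:R * d))).
by rewrite ger0_norm.
Qed.

Lemma ramp_continuous : continuous ramp.
Proof.
move=> z; apply/cvgrPdist_lt => e e0; near=> y.
apply: le_lt_trans (ramp_lip _ _) _; near: y.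
exact: (@nbhsx_ballx R R z e e0).
Unshelve. all: by end_near. Qed.

(** Walk from [y] to [z] in steps of length at most [d]: [Num.trunc (|y - z| / d) + 1] of them
    suffice, each costing [e]. This affine bound stands in for a Lipschitz estimate. *)
Lemma modulus_growth g d e : 0 < d -> 0 <= e ->
  (forall y z, `|y - z| <= d -> `|g y - g z| <= e) ->
  forall y z, `|g y - g z| <= e + e / d * `|y - z|.
Proof.
move=> d0 e0 ge y z.
have chain n u v : `|u - v| <= n%:R * d -> `|g u - g v| <= n%:R * e.
  elim: n v => [|n IHn] v.
    by rewrite !mul0r normr_le0 subr_eq0 => /eqP ->; rewrite subrr normr0.
  move=> uv; have n1 : (0 : R) < n.+1%:R by rewrite ltr0n.
  (* The point reached after [n] of [n + 1] equal steps from [u] to [v]. *)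
  pose m := u + n%:R / n.+1%:R * (v - u).
  have -> : g u - g v = (g u - g m) + (g m - g v) by ring.
  rewrite -natr1 mulrDl mul1r; apply: le_trans (ler_normD _ _) _; apply: lerD.
    apply: IHn; rewrite /m opprD addNKr normrN normrM distrC.
    rewrite ger0_norm ?divr_ge0// mulrAC -mulrA ler_wpM2l//.
    by rewrite ler_pdivrMr// mulrC.
  apply: ge; have -> : m - v = n.+1%:R^-1 * (u - v).
    by rewrite /m -natr1; field; rewrite natr1 gt_eqF.
  by rewrite normrM normfV (ger0_norm (ler0n R n.+1)) ler_pdivrMl.
have yd : 0 <= `|y - z| / d by rewrite divr_ge0// ltW.
have /andP[tl tr] := trunc_itv yd.
apply: le_trans (chain (Num.trunc (`|y - z| / d)).+1 y z _) _.
  by rewrite -ler_pdivrMr// ltW.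
rewrite -natr1 mulrDl mul1r addrC lerD2l mulrAC -mulrA mulrC ler_wpM2l// .
Qed.

End interpolation.

(** * Composition of a random function with a random variable *)

Section superposition.
Context (R : realType) (T : R) (Ps : set (probability (Omega T) R)).
Hypothesis T_gt0 : 0 < T.
Implicit Types (f Z : Omega T -> R) (g : Omega T -> R -> R).

(** Turns the affine bound of [modulus_growth] into closeness of composites; factoring out [K]
    leaves the additive constant [c / K]. *)
Lemma L1close_lip (K c e : R) f f' Z Z' : 0 < K -> 0 <= c ->
  (forall w, `|f w - f' w| <= c + K * `|Z w - Z' w|) ->
  L1close Ps e Z Z' -> L1close Ps (c + K * e) f f'.
Proof.
move=> K0 c0 ff ZZ Q PQ.
have -> : c + K * e = K * (e + c / K) by field; rewrite gt_eqF.
rewrite EFinM EFinD.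
apply: le_trans (_ : _ <= K%:E * (\int[Q]_w (`|Z w - Z' w|)%:E + (c / K)%:E))%E _.
  apply: lower_integral_le_affine => //; first by rewrite divr_ge0// ltW.
  move=> w; rewrite -EFinD -EFinM lee_fin (le_trans (ff w))//.
  by rewrite mulrDr addrC mulrCA divff ?gt_eqF// mulr1.
by rewrite lee_pmul2l// leeD2r// ZZ.
Qed.

Lemma interp_measurable n g Z x d : (forall y, measurable_fun setT (g^~ y)) ->
  measurable_fun setT Z -> measurable_fun setT (fun w => interp n (g w) x d (Z w)).
Proof.
move=> mg mZ; elim: n => [|n IHn] //=.
apply: measurable_funD => //; apply: measurable_funM; last exact: measurable_funB.
apply: measurableT_comp => //.
  by apply: continuous_measurable_fun; exact: ramp_continuous.
by apply: measurable_funM => //; exact: measurable_funB.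
Qed.

(** The randomness of the argument sits in the ramps, which are bounded continuous functions of the
    path; [g] is evaluated at deterministic nodes only. *)
Lemma interp_qcont n g Y x d : (forall y, qcont Ps (g^~ y)) ->
  continuous Y -> qcont Ps (fun w => interp n (g w) x d (Y w)).
Proof.
move=> qg cY; elim: n => [|n IHn] //=.
apply: qcontD => //; apply: (qcontM (M := 1)) => //; last 2 first.
- by move=> w; have /andP[r0 r1] := ramp_itv (d^-1 * (Y w - (x + n%:R * d))); rewrite ger0_norm.
- exact: qcontB.
move=> w; apply: (@continuous_comp _ _ _ (fun w => d^-1 * (Y w - (x + n%:R * d))) (@ramp R)).
  apply: continuousM; first exact: cst_continuous.
  by apply: continuousB; [exact: cY|exact: cst_continuous].
exact: ramp_continuous.
Qed.

Lemma superposition_measurable g Z :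
  (forall e, 0 < e -> exists2 d, 0 < d &
     forall w x y, `|x - y| <= d -> `|g w x - g w y| <= e) ->
  (forall y, measurable_fun setT (g^~ y)) ->
  measurable_fun setT Z -> measurable_fun setT (fun w => g w (Z w)).
Proof.
move=> ug mg mZ.
(* Mesh [1 / (n + 1)] on the interval from [- (n + 1)] to [n + 1]: the mesh shrinks while the range
   exhausts the line. *)
pose F n w := interp (n.+1 * (n.+1 + n.+1)) (g w) (- n.+1%:R) (n.+1%:R^-1) (Z w).
apply: (@measurable_fun_cvg _ _ _ _ F) => //.
  by move=> n; exact: interp_measurable.
move=> w _; apply/cvgrPdist_le => e e0.
have [d d0 gd] := ug e e0.
near=> n; rewrite distrC.
have n0 : (0 : R) < n.+1%:R by rewrite ltr0n.
apply: interp_close; first by rewrite invr_gt0.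
  move=> y z yz; apply: gd; apply: le_trans yz _.
  near: n; have := near_infty_natSinv_lt (PosNum d0); by apply: filterS => n /ltW.
have -> : - n.+1%:R + (n.+1 * (n.+1 + n.+1))%:R * n.+1%:R^-1 = n.+1%:R :> R.
  by rewrite natrM [(n.+1 + n.+1)%:R]natrD; field; rewrite gt_eqF.
rewrite -ler_norml; apply: (@le_trans _ _ n%:R); last by rewrite ler_nat.
by apply: ltW; near: n; exact: nbhs_infty_gtr.
Unshelve. all: by end_near. Qed.

Lemma superposition_qcont g Z :
  (forall e, 0 < e -> exists2 d, 0 < d &
     forall w x y, `|x - y| <= d -> `|g w x - g w y| <= e) ->
  (forall y, qcont Ps (g^~ y)) -> qcont Ps Z -> qcont Ps (fun w => g w (Z w)).
Proof.
move=> ug qg qZ; have mg y : measurable_fun setT (g^~ y) by have [] := qg y.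
have mZ : measurable_fun setT Z by have [] := qZ.
have mgZ : measurable_fun setT (fun w => g w (Z w)) by exact: superposition_measurable.
apply: qcont_approx => // e e0.
have e4 : 0 < e / 4 by rewrite divr_gt0.
have [d d0 gd] := ug _ e4.
have [_ /(_ d d0)[Y [cY [M YM] ZY]]] := qZ.
have M0 : 0 <= M by apply: le_trans (YM point).
have Md : 0 <= (M + M) / d by rewrite divr_ge0 ?addr_ge0// ltW.
(* Enough cells of width [d] to cover the range of [Y], which lies between [- M] and [M]. *)
pose n := (Num.trunc ((M + M) / d)).+1.
have mY := continuous_measurable_Omega cY.
have mgY : measurable_fun setT (fun w => g w (Y w)) by exact: superposition_measurable.
have qi := interp_qcont n (- M) d qg cY; exists (fun w => interp n (g w) (- M) d (Y w)) => //.
(* The bracket pays for replacing [Z] by [Y], by [modulus_growth]; the remaining [e / 2] covers the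
   interpolation error [e / 4]. *)
have -> : e = (e / 4 + e / 4 / d * d) + e / 2.
  by field; rewrite gt_eqF.
apply: (@L1close_trans _ _ _ (fun w => g w (Y w))) => //; first by case: qi.
  apply: (@L1close_lip _ _ _ _ _ Z Y) => //; first by rewrite divr_gt0.
    exact: ltW.
  by move=> w; apply: modulus_growth => //; [exact: ltW|exact: gd].
apply: L1close_pointwise => w; rewrite distrC.
apply: (@le_trans _ _ (e / 4)); last by lra.
apply: interp_close => //; first exact: gd.
have := YM w; rewrite ler_norml => /andP[-> YM'] /=.
apply: le_trans YM' _; rewrite -lerBlDl opprK -ler_pdivrMr//.
by have /andP[_ /ltW] := trunc_itv Md.
Qed.

End superposition.

(** * Auxiliary facts on extended reals, powers, matrix norms and suprema *)

Lemma cvg_lt_ereal (R : realType) (u : (\bar R)^nat) (l e : \bar R) :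
  (l < e)%E -> u k @[k --> \oo] --> l -> \forall k \near \oo, (u k < e)%E.
Proof.
move=> le ul; apply: (ul [set x | x < e]%E).
by apply: open_nbhs_nbhs; split; [exact: open_ereal_lt_ereal|].
Qed.

Lemma ge0_cvge0 (R : realType) (u : (\bar R)^nat) : (forall k, 0 <= u k)%E ->
  (forall e, 0 < e -> \forall k \near \oo, (u k < e%:E)%E) ->
  u k @[k --> \oo] --> 0%E.
Proof.
move=> u0 ue U /= [e /= e0 eU]; apply: filterS (ue e e0) => k /= uk.
have := u0 k; move: uk; case: (u k) => [r||]//; rewrite lte_fin lee_fin => re r0.
by apply: eU => /=; rewrite sub0r normrN ger0_norm.
Qed.

Lemma poweR_inv_lt (R : realType) (x : \bar R) (e p : R) : 0 < p -> 0 < e ->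
  (0 <= x)%E -> (x `^ p^-1 < e%:E)%E -> (x < (e `^ p)%:E)%E.
Proof.
move=> p0 e0 x0; apply: contraTT; rewrite -!leNgt => ex.
have -> : e%:E = (((e `^ p)%:E) `^ p^-1)%E.
  by rewrite poweR_EFin -powRrM divff ?gt_eqF// powRr1// ltW.
apply: gt0_ler_poweR => //; first by rewrite invr_ge0 ltW.
- by rewrite in_itv/= lee_fin powR_ge0 leey.
- by rewrite in_itv/= x0 leey.
Qed.

(* On |x| >= e the factor (|x| / e) ^ (p - 1) is at least 1. *)
Lemma norm_le_powR (R : realType) (x e p : R) : 1 <= p -> 0 < e ->
  `|x| <= (e `^ (p - 1))^-1 * (`|x| `^ p + e `^ p).
Proof.
move=> p1 e0; have E y : 0 <= y -> y `^ p = y * y `^ (p - 1).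
  move=> y0; have := mulr_powRB1 y0 (lt_le_trans ltr01 p1).
  by move=> <-.
have c0 : 0 < e `^ (p - 1) by exact: powR_gt0.
rewrite mulrC ler_pdivlMr//; case: (leP `|x| e) => xe.
  apply: le_trans (_ : e `^ p <= _); last by rewrite lerDr powR_ge0.
  by rewrite E ?(ltW e0)// ler_wpM2r// ltW.
apply: le_trans (_ : `|x| `^ p <= _); last by rewrite lerDl powR_ge0.
rewrite E//; apply: ler_wpM2l => //; apply: ge0_ler_powR; rewrite ?nnegrE ?subr_ge0 ?(ltW e0) ?(ltW xe)//.
Qed.

Lemma mx_norm_leP (R : realType) (m n : nat) (x : 'M[R]_(m, n)) (r : R) :
  0 <= r -> (forall i j, `|x i j| <= r) -> `|x| <= r.
Proof.
move=> r0 xr; rewrite [leLHS](mx_normrE x); apply: bigmax_le => // -[i j] _.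
Qed.

Lemma entry_le_mx_norm (R : realType) (m n : nat) (x : 'M[R]_(m, n)) i j :
  `|x i j| <= `|x|.
Proof.
rewrite [leRHS](mx_normrE x).
exact: (le_bigmax _ (fun ij => `|x ij.1 ij.2|) (i, j)).
Qed.

Lemma sup_close (R : realType) (I : Type) (D : set I) (F G : I -> R) (r : R) :
  D !=set0 -> has_ubound (F @` D) -> has_ubound (G @` D) ->
  (forall i, D i -> `|F i - G i| <= r) ->
  `|sup (F @` D) - sup (G @` D)| <= r.
Proof.
move=> D0; have half F' G' : has_ubound (G' @` D) ->
    (forall i, D i -> F' i <= G' i + r) -> sup (F' @` D) <= sup (G' @` D) + r.
  move=> uG FG; apply: ge_sup; first by case: D0 => i Di; exists (F' i), i.
  move=> _ [i Di <-]; apply: le_trans (FG _ Di) _; rewrite lerD2r.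
  by apply: ub_le_sup => //; exists i.
move=> uF uG FG; rewrite ler_norml.
have := half F G uG; have := half G F uF => h1 h2.
have {}h1 : sup (G @` D) <= sup (F @` D) + r.
  by apply: h1 => i /FG; rewrite ler_norml; lra.
have {}h2 : sup (F @` D) <= sup (G @` D) + r.
  by apply: h2 => i /FG; rewrite ler_norml; lra.
by lra.
Qed.

(** * Uniform continuity of paths and regularity of simple processes *)

Section frozen_functions.
Context (R : realType) (T : R).
Hypothesis T_gt0 : 0 < T.

(** Heine's theorem: compactness makes the small radius uniform over [[0, T]], and clamping reduces
    arbitrary pairs to points of [[0, T]] without increasing their distance. *)
Lemma frozen_unif_continuous (g : R -> R) : continuous g ->
  (forall t, g t = g (clamp T t)) ->
  forall e, 0 < e -> exists2 d, 0 < d &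
    forall x y, `|x - y| <= d -> `|g x - g y| <= e.
Proof.
move=> cg gf e e0.
have cov := (compact_near_coveringP `[0, T]).1 (@segment_compact R 0 T).
have := cov R (at_right 0) (fun d x => forall y, `|x - y| <= d -> `|g x - g y| <= e) _.
case.
  move=> x _; have e2 : 0 < e / 2 by rewrite divr_gt0.
  have /cvgrPdist_lt/(_ _ e2) := cg x.
  move=> /nbhs_ballP[d /= d0 dg]; have d2 : 0 < d / 2 by rewrite divr_gt0.
  exists (ball x (d / 2), [set c | c < d / 2]); first split => /=.
  - exact: nbhsx_ballx.
  - exact: nbhs_right_lt.
  move=> [x' c] [/= xx' cd] y x'y.
  have g1 : `|g x - g x'| < e / 2.
    by apply: dg; apply: le_ball xx'; lra.
  have g2 : `|g x - g y| < e / 2.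
    apply: dg; rewrite /ball/=; apply: le_lt_trans (ler_distD x' _ _) _.
    by move: xx' x'y cd; rewrite /ball/=; lra.
  apply: le_trans (ler_distD (g x) _ _) _; rewrite distrC.
  by lra.
move=> d /= d0 dP; exists (d / 2); first by rewrite divr_gt0.
move=> x y xy; rewrite gf (gf y); apply: (dP (d / 2)) => /=.
- by rewrite /ball/= sub0r normrN gtr0_norm; lra.
- by rewrite divr_gt0.
- by rewrite in_itv/=; exact: clamp_in.
- exact: le_trans (clamp_lip _ _ _) xy.
Qed.

Lemma path_unif_continuous (w : Omega T) (e : R) : 0 < e ->
  exists2 d, 0 < d & forall x y, `|x - y| <= d -> `|w x - w y| <= e.
Proof.
by apply: frozen_unif_continuous; [exact: path_continuous|exact: path_frozen].
Qed.

Lemma continuous_OmegaP (f : Omega T -> R) :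
  (forall w e, 0 < e -> \forall w' \near w, `|f w - f w'| < e) -> continuous f.
Proof.
move=> H w; apply: (iffRL (@cvgrPdist_lt R R (Omega T) (nbhs w) (nbhs_filter w) f (f w))).
by move=> e e0; exact: H.
Qed.

(** One estimate with two uses: [w = w'] gives regularity in time, [s = t] gives continuity in the
    path. It rests on the times [t_i] capped at [s] and at [t] differing by at most [|s - t|]. *)
Lemma SG0_regular (eta : R -> Omega T -> R) : SG0 eta ->
  exists M C, [/\ 0 <= C, forall t w, 0 <= t <= T -> `|eta t w| <= M &
    forall s t (w w' : Omega T) r, 0 <= s <= T -> 0 <= t <= T -> `|s - t| <= r ->
      (forall u v, `|u - v| <= `|s - t| -> `|w u - w' v| <= r) ->
      `|eta s w - eta t w'| <= C * r].
Proof.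
move=> [n [ts [f [ts_in [[M0 [_ fM]] [C0 [_ fC]]] etaE]]]].
(* [lipschitz] speaks of all constants beyond a threshold [C0] that may be negative; [C] is strictly
   beyond it and nonnegative. *)
pose C := Num.max 0 C0 + 1; have C_C0 : C0 < C.
  by rewrite (@le_lt_trans _ _ (Num.max 0 C0)) ?ltrDl// le_max lexx orbT.
have C_ge0 : 0 <= C by rewrite addr_ge0// le_max lexx.
exists (M0 + 1), C; split => //.
  by move=> t w tT; rewrite etaE//; apply: fM => //; rewrite ltrDl.
move=> s t w w' r sT tT st ww; rewrite !etaE//.
set x := row_mx _ _; set y := row_mx _ _.
apply: le_trans (fC C C_C0 (x, y) _) _ => //=.
apply: ler_wpM2l => //; apply: mx_norm_leP; first exact: le_trans st.
move=> i j; rewrite !mxE; case: splitP => k _; rewrite !mxE //.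
apply: ww; have st' := ler_norm (s - t).
have ts' := ler_norm (t - s); rewrite distrC in ts'.
by rewrite ler_norml; case: (leP _ s) => ?; case: (leP _ t) => ?; lra.
Qed.

Lemma SG0_continuous (eta : R -> Omega T -> R) (t : R) : SG0 eta ->
  0 <= t <= T -> continuous (eta t).
Proof.
move=> /SG0_regular[M [C [C0 _ reg]]] tT; apply: continuous_OmegaP => w e e0.
have r0 : 0 < e / (C + 1) by rewrite divr_gt0// ltr_wpDl.
have [d d0 wd] := path_unif_continuous w r0.
apply: (@filterS (Omega T) (nbhs w) (nbhs_filter w) _ _ _ (near_path T_gt0 w r0)) => w' ww'.
apply: le_lt_trans (reg _ _ _ _ (e / (C + 1)) tT tT _ _) _.
- by rewrite subrr normr0 ltW.
- move=> u v; rewrite subrr normr0 normr_le0 subr_eq0 => /eqP ->.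
  exact: ltW.
- rewrite mulrA ltr_pdivrMr ?ltr_wpDl// mulrC ltr_pM2l//.
  by rewrite ltrDl.
Qed.

End frozen_functions.

(** * Quasi-continuity and time continuity of processes in $S_G^p$ *)

Section process_space.
Context (R : realType) (T : R) (Ps : set (probability (Omega T) R)).
Hypotheses (T_gt0 : 0 < T) (Ps_compact : weakly_compact Ps).

(** The pointwise bound of [norm_le_powR] at level [e / 2] takes the place of Hölder's inequality
    and combines with the lower integral of the supremum; each of its two terms contributes at most
    [e / 2]. *)
Lemma SG_approx (p : R) (S : R -> Omega T -> R) (e : R) : 1 <= p -> SG Ps p S ->
  0 < e -> exists2 eta, SG0 eta &
    forall t, 0 <= t <= T -> L1close Ps e (S t) (eta t).
Proof.
move=> p1 [mS _ [eta_ eta0 cvg]] e0; have e2 : 0 < e / 2 by rewrite divr_gt0.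
have p0 : 0 < p := lt_le_trans ltr01 p1.
have : (0 < (e / 2)%:E)%E by rewrite lte_fin.
move=> /cvg_lt_ereal/(_ cvg)[k _ /(_ k (leqnn k)) /= sk].
exists (eta_ k) => // t tT Q PQ.
pose g w := ereal_sup [set ((`|S t w - eta_ k t w| `^ p)%R)%:E | t in `[0%R, T]].
have {}sk : ((Ehat Ps g `^ p^-1) < (e / 2)%:E)%E by exact: sk.
have g0 w : (0 <= g w)%E.
  apply: le_trans (_ : ((`|S 0 w - eta_ k 0 w| `^ p)%:E <= _)%E).
    by rewrite lee_fin powR_ge0.
  by apply: ereal_sup_ubound; exists 0 => //; rewrite /= in_itv/= lexx ltW.
have Qg : (\int[Q]_w g w <= ((e / 2) `^ p)%:E)%E.
  apply: le_trans (ltW (poweR_inv_lt p0 e2 _ sk)).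
    by apply: ereal_sup_ubound; exists Q.
  apply: le_trans (_ : (\int[Q]_w g w <= _)%E); first exact: integral_ge0.
  by apply: ereal_sup_ubound; exists Q.
have K0 : 0 < ((e / 2) `^ (p - 1))^-1 by rewrite invr_gt0 powR_gt0.
have c0 : 0 <= (e / 2) `^ p by rewrite powR_ge0.
apply: le_trans (_ : _ <= ((e / 2) `^ (p - 1))^-1%:E *
    (\int[Q]_w g w + ((e / 2) `^ p)%:E))%E _.
  apply: lower_integral_le_affine => // w.
  apply: le_trans (_ : _ <= ((e / 2) `^ (p - 1))^-1%:E *
    ((`|S t w - eta_ k t w| `^ p)%:E + ((e / 2) `^ p)%:E))%E _.
    by rewrite -EFinD -EFinM lee_fin norm_le_powR.
  rewrite lee_pmul2l// leeD2r//; apply: ereal_sup_ubound; exists t => //.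
apply: le_trans (_ : _ <= ((e / 2) `^ (p - 1))^-1%:E *
    (((e / 2) `^ p)%:E + ((e / 2) `^ p)%:E))%E _.
  by rewrite lee_pmul2l// leeD2r.
rewrite -EFinD -EFinM lee_fin -(mulr_powRB1 (ltW e2) p0) -mulrDl mulrC.
by rewrite -mulrA divff ?mulr1 -?splitr// gt_eqF// powR_gt0.
Qed.

Lemma SG_qcont (p : R) (S : R -> Omega T -> R) (t : R) : 1 <= p -> SG Ps p S ->
  0 <= t <= T -> qcont Ps (S t).
Proof.
move=> p1 SGS tT; apply: qcont_approx => //; first by case: SGS => mS _ _; exact: mS.
move=> e e0; have [eta eta0 Seta] := SG_approx p1 SGS e0.
exists (eta t); last exact: Seta.
have [M [C [C0 etaM _]]] := SG0_regular eta0.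
apply: (@qcont_continuous _ _ _ _ M) => //; last by move=> w; exact: etaM.
exact: SG0_continuous.
Qed.

(** Paths have no common modulus of continuity, so the limit is taken under each measure first. The
    largest increment [D n] over a window of radius [1 / (n + 1)] is a bounded continuous function
    of the path that tends to 0 pointwise. Dominated convergence makes its mean under [Q] small for
    some [n], weak continuity keeps it small near [Q], and compactness of [Ps] yields one window for
    all measures. *)
Lemma SG0_time_continuous (eta : R -> Omega T -> R) (t e : R) : SG0 eta ->
  0 < e -> \forall s \near t, L1close Ps e (eta (clamp T s)) (eta (clamp T t)).
Proof.
move=> eta0 e0; have [M [C [C0 etaM reg]]] := SG0_regular eta0.
pose F w s := `|eta (clamp T s) w - eta (clamp T t) w|.
pose B n : set R := [set s | `|s - t| <= n.+1%:R^-1].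
pose D n w := sup (F w @` B n).
have Bt n : B n t by rewrite /B/= subrr normr0 invr_ge0.
have FM w s : F w s <= M + M.
  by apply: le_trans (ler_normB _ _) _; apply: lerD; apply: etaM; exact: clamp_in.
have ubF w n : has_ubound (F w @` B n) by exists (M + M) => _ [s _ <-].
have FD n w s : B n s -> F w s <= D n w.
  by move=> Bs; apply: ub_le_sup => //; exists s.
have D0 n w : 0 <= D n w by apply: le_trans (FD n w t (Bt n)); rewrite normr_ge0.
have D_le n w r : (forall s, B n s -> F w s <= r) -> D n w <= r.
  move=> Fr; apply: ge_sup; first by exists (F w t), t.
  by move=> _ [s Bs <-]; exact: Fr.
have DM n w : `|D n w| <= M + M by rewrite ger0_norm//; exact: D_le.
have cD n : continuous (D n).
  apply: continuous_OmegaP => w r r0.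
  have r'0 : 0 < r / ((C + C) + 1) by rewrite divr_gt0// ltr_wpDl// addr_ge0.
  apply: (@filterS (Omega T) (nbhs w) (nbhs_filter w) _ _ _ (near_path T_gt0 w r'0)) => w' ww'.
  have etaC s : `|eta (clamp T s) w - eta (clamp T s) w'| <= C * (r / ((C + C) + 1)).
    apply: reg; try exact: clamp_in; first by rewrite subrr normr0 ltW.
    by move=> u v; rewrite subrr normr0 normr_le0 subr_eq0 => /eqP ->; exact: ltW.
  apply: le_lt_trans (_ : (C + C) * (r / ((C + C) + 1)) < _); last first.
    rewrite mulrA ltr_pdivrMr ?ltr_wpDl ?addr_ge0// mulrC ltr_pM2l//.
    by rewrite ltrDl.
  apply: sup_close => //; first by exists t.
  move=> s _; apply: le_trans (ler_dist_dist _ _) _.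
  rewrite opprD addrACA -opprD mulrDl; apply: le_trans (ler_normB _ _) _.
  exact: lerD.
have mD n := continuous_measurable_Omega (cD n).
have D_cvg w : (D n w)%:E @[n --> \oo] --> 0%E.
  apply: ge0_cvge0 => [n|r r0]; first by rewrite lee_fin.
  have r'0 : 0 < r / (C + 1) by rewrite divr_gt0// ltr_wpDl.
  have [d d0 wd] := path_unif_continuous T_gt0 w r'0.
  have md : 0 < Num.min d (r / (C + 1)) by rewrite lt_min d0.
  apply: filterS (near_infty_natSinv_lt (PosNum md)) => n /=.
  rewrite lt_min => /andP[nd nr]; rewrite lte_fin.
  apply: le_lt_trans (_ : C * (r / (C + 1)) < _); last first.
    by rewrite mulrA ltr_pdivrMr ?ltr_wpDl// mulrC ltr_pM2l// ltrDl.
  apply: D_le => s Bs; have cs := le_trans (clamp_lip T_gt0 s t) Bs.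
  apply: reg; try exact: clamp_in; first exact: le_trans cs (ltW nr).
  by move=> u v uv; apply: wd; apply: le_trans uv (le_trans cs (ltW nd)).
have intD (Q : probability (Omega T) R) :
    exists n, (\int[Q]_w (D n w)%:E < (e / 2)%:E)%E.
  have m1 n : measurable_fun setT (fun w => (D n w)%:E) by exact/measurable_EFinP.
  have jM : Q.-integrable setT (cst (M + M)%:E).
    by apply: (@bounded_integrable _ _ (cst (M + M)) `|M + M|).
  have DM' n w : [set: Omega T] w -> (`|(D n w)%:E| <= cst (M + M)%:E w)%E.
    by move=> _; rewrite lee_fin; exact: DM.
  have fM w : [set: Omega T] w -> cst (M + M)%:E w \is a fin_num by [].
  have D0_lim := dominated_cvg measurableT m1 (fun w _ => D_cvg w) fM jM DM'.
  have int0 : (\int[Q]_w (0) < (e / 2)%:E)%E.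
    by rewrite integral0_eq// lte_fin divr_gt0.
  by have [n _ /(_ n (leqnn n)) Dn] := cvg_lt_ereal int0 D0_lim; exists n.
have cov := (compact_near_coveringP (Ps : set (weak_law T))).1 Ps_compact.
have := cov R (nbhs t) (fun s Q => (\int[Q : probability (Omega T) R]_w
  (`|eta (clamp T s) w - eta (clamp T t) w|)%:E <= e%:E)%E) _.
case.
  move=> Q PQ; have [n Dn] := intD Q.
  have e2 : 0 < e / 2 by rewrite divr_gt0.
  (* A weak neighbourhood of [Q] paired with the time window on which [D n] controls the
     increment. *)
  exists ([set Q' | `| \int[Q : probability (Omega T) R]_w D n w
                     - \int[Q' : probability (Omega T) R]_w D n w | < e / 2], B n).
    split => /=; first exact: weak_near (cD n) (DM n) e2.
    apply/nbhs_ballP; exists n.+1%:R^-1; first by rewrite /= invr_gt0.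
    by move=> s; rewrite /ball/= distrC => /ltW.
  move=> [Q' s] [/= QQ' Bs].
  apply: le_trans (_ : _ <= \int[(Q' : probability (Omega T) R)]_w (D n w)%:E)%E _.
    by apply: ge0_lower_integral_le => w; rewrite lee_fin//; exact: FD.
  rewrite mean_EFin; last exact: bounded_integrable (DM n).
  move: Dn; rewrite mean_EFin ?lte_fin ?lee_fin; last exact: bounded_integrable (DM n).
  by move: QQ'; rewrite ltr_norml; lra.
by move=> d /= d0 dP; apply/nbhs_ballP; exists d => // s ts Q PQ; exact: dP PQ.
Qed.

Lemma SG_time_continuous (p : R) (S : R -> Omega T -> R) (t e : R) :
  1 <= p -> SG Ps p S -> 0 < e ->
  \forall s \near t, L1close Ps e (S (clamp T s)) (S (clamp T t)).
Proof.
move=> p1 SGS e0; have e3 : 0 < e / 3 by rewrite divr_gt0.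
have [eta eta0 Seta] := SG_approx p1 SGS e3.
have mS s : measurable_fun setT (S (clamp T s)).
  by case: SGS => mS _ _; apply: mS; exact: clamp_in.
have meta s : measurable_fun setT (eta (clamp T s)).
  by apply: continuous_measurable_Omega; apply: SG0_continuous => //; exact: clamp_in.
apply: filterS (SG0_time_continuous t eta0 e3) => s st.
have -> : e = e / 3 + (e / 3 + e / 3) by field.
apply: (L1close_trans (g := eta (clamp T s))) => //; first by apply: Seta; exact: clamp_in.
apply: (L1close_trans (g := eta (clamp T t))) => //.
by apply: L1closeC; apply: Seta; exact: clamp_in.
Qed.

End process_space.

(** * The constraint function $H$ *)

Section constraint_function.
Context (R : realType) (T : R) (Ps : set (probability (Omega T) R)).
Hypotheses (T_gt0 : 0 < T) (Ps_compact : weakly_compact Ps) (Ps0 : Ps !=set0).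
Variables (l : Omega T -> R -> R -> R) (p : R) (S : R -> Omega T -> R).
Hypotheses (l_Hl : Hl Ps l) (S_HS : HS Ps l p S).

Lemma qs_null (E : set (Omega T)) : qs Ps E -> exists2 N, measurable N &
  (forall Q, Ps Q -> Q N = 0%E) /\ ~` N `<=` E.
Proof.
move=> [N [mN PsN NE]]; exists N => //; split => // Q PQ.
apply/eqP; rewrite eq_le measure_ge0 andbT -PsN.
by apply: ereal_sup_ubound; exists Q.
Qed.

Lemma Lip_continuous (xi : Omega T -> R) : Lip xi ->
  continuous xi /\ exists M, forall w, `|xi w| <= M.
Proof.
move=> [n [ts [f [_ [[M0 [_ fM]] [C0 [_ fC]]] ->]]]]; split; last first.
  by exists (M0 + 1) => w; apply: fM => //; rewrite ltrDl.
pose C := Num.max 0 C0 + 1; have C_C0 : C0 < C.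
  by rewrite (@le_lt_trans _ _ (Num.max 0 C0)) ?ltrDl// le_max lexx orbT.
have C_gt0 : 0 < C by rewrite ltr_wpDl// le_max lexx.
apply: continuous_OmegaP => w e e0.
have r0 : 0 < e / 2 / C by rewrite !divr_gt0.
apply: (@filterS (Omega T) (nbhs w) (nbhs_filter w) _ _ _ (near_path T_gt0 w r0)) => w' ww'.
apply: le_lt_trans (_ : C * (e / 2 / C) < _); last first.
  by rewrite mulrCA divff ?gt_eqF// mulr1; lra.
apply: le_trans (fC C C_C0 (_, _) _) _ => //=.
apply: ler_wpM2l; first exact: ltW.
apply: mx_norm_leP; first exact: ltW.
by move=> i j; rewrite !mxE; apply: ltW; exact: ww'.
Qed.

Lemma LG1_qcont (xi : Omega T -> R) : LG Ps 1 xi -> qcont Ps xi.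
Proof.
move=> [mxi [xi_ Lxi cvg]]; apply: qcont_approx => // e e0.
have : (0 < e%:E)%E by rewrite lte_fin.
move=> /cvg_lt_ereal/(_ cvg)[k _ /(_ k (leqnn k)) xik].
have [cxi [M xiM]] := Lip_continuous (Lxi k).
exists (xi_ k); first exact: (qcont_continuous Ps cxi xiM).
move=> Q PQ; have := poweR_inv_lt ltr01 e0 _ xik; rewrite powRr1 ?(ltW e0)// => lt_e.
have le_sup : (\int[Q]_w (`|xi w - xi_ k w|)%:E <=
    Ehat Ps (fun w => (`|xi w - xi_ k w| `^ 1)%:E))%E.
  under eq_integral do rewrite -[X in X%:E]powRr1//.
  by apply: ereal_sup_ubound; exists Q.
have E0 : (0 <= Ehat Ps (fun w => (`|xi w - xi_ k w| `^ 1)%:E))%E.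
  apply: le_trans _ le_sup; apply: integral_ge0 => w _.
  by rewrite lee_fin.
exact: le_trans le_sup (ltW (lt_e E0)).
Qed.

Lemma l_modulus (e : R) : 0 < e -> exists2 d, 0 < d &
  forall w s t x y, 0 <= s <= T -> 0 <= t <= T ->
    `|s - t| <= d -> `|x - y| <= d -> `|l w s x - l w t y| <= e.
Proof.
move=> e0; have [/(_ e e0)[d d0 ld] _ _ _] := l_Hl.
exists (d / 2) => [|w s t x y sT tT st xy]; first by rewrite divr_gt0.
by apply: ltW; apply: ld => //; lra.
Qed.

Lemma l_qcont (t x : R) : 0 <= t <= T -> qcont Ps (fun w => l w t x).
Proof. by move=> tT; apply: LG1_qcont; case: l_Hl => _ _ /(_ t tT)[]. Qed.

Lemma loss_qcont (t a : R) (Z : Omega T -> R) : 0 <= t <= T -> qcont Ps Z ->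
  qcont Ps (fun w => l w t (Z w + a)).
Proof.
move=> tT qZ.
pose g w x := l w t (x + a).
suff : qcont Ps (fun w => g w (Z w)) by [].
apply: superposition_qcont => // [e e0|y]; last exact: l_qcont.
have [d d0 ld] := l_modulus e0; exists d => // w x y xy.
by apply: ld => //; [rewrite subrr normr0 ltW|rewrite opprD addrACA subrr addr0].
Qed.

(** Clamping the time defines $H$ on the whole line, constant in time off [[0, T]], so that time
    neighbourhoods are two-sided even at the endpoints. *)
Definition constraint (t a : R) : R :=
  upper Ps (fun w => l w (clamp T t) (S (clamp T t) w + a)).

Let p_ge1 : 1 <= p. Proof. by case: S_HS. Qed.
Let S_SG : SG Ps p S. Proof. by case: S_HS. Qed.

Let S_qcont t : qcont Ps (S (clamp T t)).
Proof. by apply: (SG_qcont T_gt0 p_ge1 S_SG); exact: clamp_in. Qed.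

Lemma constraint_qcont (t a : R) :
  qcont Ps (fun w => l w (clamp T t) (S (clamp T t) w + a)).
Proof. by apply: loss_qcont => //; exact: clamp_in. Qed.

Lemma constraint_continuous (t a e : R) : 0 < e -> exists2 d, 0 < d &
  forall s b, `|t - s| < d -> `|a - b| < d ->
    `|constraint t a - constraint s b| < e.
Proof.
move=> e0; have e4 : 0 < e / 4 by rewrite divr_gt0.
have [d d0 ld] := l_modulus e4; have d8 : 0 < d / 8 by rewrite divr_gt0.
have := SG_time_continuous T_gt0 Ps_compact t p_ge1 S_SG d8.
move=> /nbhs_ballP[c /= c0 cS].
have K0 : 0 < e / 4 / d by rewrite divr_gt0.
exists (Num.min c d) => [|s b]; first by rewrite lt_min c0.
rewrite !lt_min => /andP[tsc tsd] /andP[_ abd].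
(* The terms [e / 4] pay for the change of time in [l], the constant of [modulus_growth] and the
   shift [b - a]; the last term, equal to [e / 32], pays for the increment of [S]. *)
have : L1close Ps (e / 4 + (e / 4 + e / 4) + e / 4 / d * (d / 8))
    (fun w => l w (clamp T s) (S (clamp T s) w + b))
    (fun w => l w (clamp T t) (S (clamp T t) w + a)).
  apply: (L1close_lip K0 (Z := S (clamp T s)) (Z' := S (clamp T t))).
  - by lra.
  - move=> w; set x := S _ w; set y := S _ w.
    apply: le_trans (ler_distD (l w (clamp T t) (x + b)) _ _) _.
    rewrite -!addrA; apply: lerD.
      apply: ld; try exact: clamp_in; last by rewrite subrr normr0 ltW.
      by apply: le_trans (clamp_lip T_gt0 _ _) _; rewrite distrC ltW.
    have := @modulus_growth R (l w (clamp T t)) d (e / 4) d0 (ltW e4) _ (x + b) (y + a).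
    move=> lg; apply: le_trans (lg _) _.
      by move=> u v uv; apply: ld => //; rewrite ?subrr ?normr0 ?(ltW d0)//; exact: clamp_in.
    rewrite lerD2l.
    apply: le_trans (_ : e / 4 / d * (d + `|x - y|) <= _); last first.
      by rewrite mulrDr lerD2r divfK ?gt_eqF.
    rewrite ler_pM2l//.
    have -> : x + b - (y + a) = (b - a) + (x - y) by ring.
    apply: le_trans (ler_normD _ _) _; rewrite lerD2r distrC; exact: ltW.
  - by apply: cS; rewrite /ball/=.
move=> /(upper_close Ps_compact Ps0 (constraint_qcont s b) (constraint_qcont t a)).
rewrite distrC => /le_lt_trans; apply.
have -> : e / 4 / d * (d / 8) = e / 32 by field; rewrite gt_eqF.
by lra.
Qed.

Lemma constraint_incr (t a b : R) : a < b -> constraint t a < constraint t b.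
Proof.
move=> ab; apply: upper_lt => //; try exact: constraint_qcont.
have [_ /(_ (clamp T t) (clamp_in T_gt0 t))[N [mN PN Nl]] _ _] := l_Hl.
by exists N; split => // w Nw; apply: Nl => //; rewrite ltrD2l.
Qed.

Lemma constraint00 : 0 <= constraint 0 0.
Proof.
have [_ _] := S_HS; rewrite -lee_fin -(EhatE Ps_compact Ps0 (constraint_qcont 0 0)).
have -> : clamp T 0 = 0 by rewrite clamp_id ?lexx ?ltW.
suff -> : EFin \o (fun w => l w 0 (S 0 w + 0)) = (fun w => (l w 0 (S 0 w))%:E) by [].
by apply/funext => w /=; rewrite addr0.
Qed.

(** A positive upper expectation of the limit yields one [Q] with a positive mean. If $H(t,\cdot)$
    were never positive, all [f n] would have nonpositive mean under [Q], and so would their limit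
    by monotone convergence. *)
Lemma constraint_pos (t0 : R) : exists a, 0 < constraint t0 a.
Proof.
apply: contrapT => /forallNP noa; set t := clamp T t0.
have tT : 0 <= t <= T := clamp_in T_gt0 t0.
have [_ /(_ t tT)/qs_null[N mN [PN Nl]] /(_ t tT)[_ limpos] _] := l_Hl.
have [_ [Q PQ <-] intpos] := ereal_sup_gt limpos.
have QN := PN Q PQ.
pose f (n : nat) w := l w t (S t w + n%:R).
have qf n : qcont Ps (f n) by exact: constraint_qcont.
have jf n := qcont_integrable PQ (qf n).
have f_le0 n : \int[Q]_w f n w <= 0.
  apply: le_trans (mean_le_upper Ps_compact Ps0 PQ (qf n)) _.
  by rewrite leNgt; apply/negP; exact: noa.
(* Subtracting the integrable [f 0] makes the sequence nonnegative off [N]. *)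
pose g (n : nat) w := (f n w - f 0%N w)%:E.
have mg n : measurable_fun (~` N) (g n).
  apply: (measurable_funS measurableT) => //; apply/measurable_EFinP.
  apply: measurable_funB; [by case: (qf n)|by case: (qf 0%N)].
have f_homo w : ~ N w -> {homo f^~ w : n m / (n <= m)%N >-> n <= m}.
  move=> /Nl lw n m; rewrite leq_eqVlt => /predU1P[->//|nm].
  by apply/ltW/lw; rewrite ltrD2l ltr_nat.
have g0 n w : (~` N) w -> (0 <= g n w)%E.
  by move=> Nw; rewrite lee_fin subr_ge0; apply: f_homo.
have g_homo w : (~` N) w -> {homo g^~ w : n m / (n <= m)%N >-> (n <= m)%E}.
  by move=> Nw n m nm; rewrite lee_fin lerD2r; apply: f_homo.
have mNC : measurable (~` N) by exact: measurableC.
have mct := @cvg_monotone_convergence _ _ _ Q _ mNC _ mg g0 g_homo.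
pose h w := limn (g^~ w).
have h_le : (\int[Q]_(w in ~` N) h w <= (- \int[Q]_w f 0%N w)%:E)%E.
  rewrite -(cvg_lim (@ereal_hausdorff R) mct); apply: lime_le.
    by apply/cvg_ex; exists (\int[Q]_(w in ~` N) h w)%E.
  apply: nearW => n /=.
  have jg : Q.-integrable setT (EFin \o (f n \- f 0%N)).
    by have := integrableB measurableT (jf n) (jf 0%N).
  rewrite -setTD -(negligible_integral mN measurableT jg QN).
  rewrite mean_EFin// RintegralB// lee_fin.
  by have := f_le0 n; lra.
have cvgg w : ~ N w -> (g n w @[n --> \oo] --> h w)%E.
  move=> Nw; have := @ereal_nondecreasing_is_cvgn R (g^~ w) (g_homo w Nw).
  by [].
(* The limit is controlled only off [N]; the value 0 on [N] makes it nonnegative and measurable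
   everywhere. *)
pose h0 := patch (cst 0%E) (~` N) h.
have h0_ge0 w : (0 <= h0 w)%E.
  rewrite /h0 patchE; case: ifPn => // /[1!inE] Nw.
  apply: lime_ge; first exact: cvgg.
  by apply: nearW => n; exact: g0.
have mh0 : measurable_fun setT h0.
  apply/(measurable_restrict _ mNC measurableT); rewrite setTI.
  exact: emeasurable_fun_cvg mg cvgg.
have inth0 : (\int[Q]_w h0 w <= (- \int[Q]_w f 0%N w)%:E)%E.
  by rewrite -integral_mkcond.
have jh0 : Q.-integrable setT h0.
  apply/integrableP; split => //; under eq_integral do rewrite gee0_abs//.
  by apply: le_lt_trans inth0 _; rewrite ltry.
(* The shift by [S t w] does not affect the limit at infinity, which may be infinite; adding back
   the finite [f 0] is therefore done in the extended reals. *)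
have limE w : ~ N w -> lim ((l w t x)%:E @[x --> +oo%R]) = (h0 w + (f 0%N w)%:E)%E.
  move=> Nw; have -> : h0 w = h w by rewrite /h0 patchE mem_set.
  have l_homo : {homo (fun x => (l w t x)%:E) : x y / x <= y >-> (x <= y)%E}.
    move=> x y; rewrite le_eqVlt => /predU1P[->//|xy].
    by rewrite lee_fin; apply/ltW/Nl.
  have l_cvg := nondecreasing_cvge l_homo.
  rewrite (cvg_lim _ l_cvg)//.
  have sn : (S t w + n%:R) @[n --> \oo] --> +oo%R.
    apply/cvgryPge => A; apply: filterS (nbhs_infty_gtr (A - S t w)) => n.
    by rewrite ltrBlDl => /ltW.
  have f_cvg : ((f n w)%:E @[n --> \oo] --> ereal_sup (range (fun x => (l w t x)%:E)))%E.
    exact: (cvg_comp _ _ sn l_cvg).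
  have gf : (g n w @[n --> \oo] --> ereal_sup (range (fun x => (l w t x)%:E)) - (f 0%N w)%:E)%E.
    have := @cvgeB _ \oo _ R (fun n => (f n w)%:E) (cst (f 0%N w)%:E) _ _ _ f_cvg (cvg_cst _).
    by apply; rewrite fin_num_adde_defl.
  by rewrite -(cvg_unique _ gf (cvgg w Nw))// subeK.
move: intpos; rewrite (eq_lower_integral_off mN QN limE) integralD//.
rewrite mean_EFin; last exact: jf.
move=> /lt_le_trans; have := leeD2r (\int[Q]_w f 0%N w)%:E inth0.
by rewrite -EFinD addNr => h1 /(_ _ h1); rewrite ltxx.
exact: jf.
Qed.

End constraint_function.

(** * Existence for the deterministic problem *)

Section deterministic_skorokhod.
Context (R : realType) (T : R).
Hypothesis T_gt0 : 0 < T.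
Variable H : R -> R -> R.
Hypothesis H_continuous : forall t a e, 0 < e -> exists2 d, 0 < d &
  forall s b, `|t - s| < d -> `|a - b| < d -> `|H t a - H s b| < e.
Hypothesis H_incr : forall t a b, a < b -> H t a < H t b.
Hypothesis H_frozen : forall t a, H t a = H (clamp T t) a.
Hypothesis H00 : 0 <= H 0 0.
Hypothesis H_pos : forall t, exists a, 0 < H t a.

Let H_le t a b : a <= b -> H t a <= H t b.
Proof. by rewrite le_eqVlt => /predU1P[->//|ab]; exact/ltW/H_incr. Qed.

Lemma near_gt0 t a : 0 < H t a -> exists2 d, 0 < d &
  forall s b, `|t - s| < d -> `|a - b| < d -> 0 < H s b.
Proof.
move=> H0; have [d d0 dH] := H_continuous t a H0.
by exists d => // s b ts ab; have := dH s b ts ab; rewrite ltr_norml; lra.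
Qed.

Lemma near_lt0 t a : H t a < 0 -> exists2 d, 0 < d &
  forall s b, `|t - s| < d -> `|a - b| < d -> H s b < 0.
Proof.
move=> H0; have /(H_continuous t a)[d d0 dH] : 0 < - H t a by rewrite oppr_gt0.
by exists d => // s b ts ab; have := dH s b ts ab; rewrite ltr_norml; lra.
Qed.

(** Since $H$ is frozen before 0, letting [s] range over all times up to [t] adds no constraint when
    [t] is nonnegative. *)
Definition feasible (t : R) : set R :=
  [set a | 0 <= a /\ forall s, s <= t -> 0 <= H s a].

Definition push (t : R) : R := inf (feasible t).

(** A level with positive $H$ at [t] works at nearby times by continuity, and so do all higher
    levels by monotonicity; compactness of [[0, T]] gives one level for all times. *)
Lemma feasible_nonempty : exists a, forall t, feasible t a.
Proof.
have cov := (compact_near_coveringP `[0, T]).1 (@segment_compact R 0 T).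
have := cov R (pinfty_nbhs R) (fun a s => 0 <= H s a) _; case.
  move=> t _; have [a /near_gt0[d d0 dH]] := H_pos t.
  exists (ball t d, [set b | a < b]); first split => /=.
  - exact: nbhsx_ballx.
  - by exists a; split => //; exact: num_real.
  move=> [s b] [/= ts ab]; apply: le_trans (H_le s (ltW ab)).
  by apply/ltW/dH => //; rewrite subrr normr0.
move=> M [_ MP]; pose a := Num.max 0 M + 1; exists a => t; split.
  by rewrite addr_ge0// le_max lexx.
move=> s _; rewrite H_frozen; apply: MP => /=.
  by rewrite /a (@le_lt_trans _ _ (Num.max 0 M)) ?ltrDl// le_max lexx orbT.
by rewrite in_itv/=; exact: clamp_in.
Qed.

Let feasible_lb t : has_lbound (feasible t).
Proof. by exists 0 => a []. Qed.

Lemma push_le t a : feasible t a -> push t <= a.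
Proof. by move=> ta; exact: ge_inf. Qed.

Lemma push_ge0 t : 0 <= push t.
Proof.
have [a ta] := feasible_nonempty; apply: lb_le_inf; first by exists a.
by move=> b [].
Qed.

(** The infimum is attained: a negative value of $H(s,\cdot)$ at [push t] would persist at feasible
    levels just above it. *)
Lemma push_feasible t : feasible t (push t).
Proof.
split; first exact: push_ge0.
move=> s st; rewrite leNgt; apply/negP => /near_lt0[d d0 dH].
have [a0 ta0] := feasible_nonempty.
have [a [a_ge0 aH] apush] := @inf_adherent _ (feasible t) d d0
  (conj (ex_intro _ a0 (ta0 t)) (feasible_lb t)).
have := aH s st; rewrite leNgt => /negP; apply; apply: dH.
  by rewrite subrr normr0.
have pa : push t <= a by exact: push_le.
by move: apush; rewrite -/(push t) ltr_norml; lra.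
Qed.

Lemma push_mono s t : s <= t -> push s <= push t.
Proof.
move=> st; apply: push_le; split; first exact: push_ge0.
by move=> u us; apply: (push_feasible t).2; exact: le_trans st.
Qed.

Lemma push0 : push 0 = 0.
Proof.
apply/eqP; rewrite eq_le push_ge0 andbT; apply: push_le; split => // s s0.
rewrite H_frozen; suff -> : clamp T s = 0 by [].
by apply/max_idPl; rewrite ge_min s0.
Qed.

Lemma constraint_push_ge0 t : 0 <= H t (push t).
Proof. exact: (push_feasible t).2. Qed.

(** From above, the level [push t + e] has positive $H$ at [t], hence stays feasible slightly later.
    From below, a violation at level [push t - e] also occurs slightly earlier. *)
Lemma push_continuous : continuous push.
Proof.
move=> t; apply/cvgrPdist_le => e e0.
have up : 0 < H t (push t + e).
  by apply: le_lt_trans (constraint_push_ge0 t) _; apply: H_incr; rewrite ltrDl.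
have [d d0 dH] := near_gt0 up.
(* If [push t - e] is negative, nonnegativity of [push] suffices. Otherwise a violation at [s <= t]
   persists at [s - c / 2], which lies in the range of constraints of [t - c / 2]. *)
have [d' d'0 dH'] : exists2 d', 0 < d' & push t - e <= push (t - d').
  have [te|te] := ltP (push t - e) 0.
    by exists 1 => //; exact: le_trans (ltW te) (push_ge0 _).
  have : ~ feasible t (push t - e) by move=> /push_le; lra.
  move=> /not_andP[//|/existsNP[s /not_implyP[st /negP]]]; rewrite -ltNge.
  move=> /near_lt0[c c0 cH]; exists (c / 2) => //; first by rewrite divr_gt0.
  rewrite leNgt; apply/negP => lt_e.
  have [_ /(_ (s - c / 2))] := push_feasible (t - c / 2).
  rewrite lerD2r => /(_ st); rewrite leNgt => /negP; apply.
  apply: le_lt_trans (H_le _ (ltW lt_e)) _; apply: cH; last by rewrite subrr normr0.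
  by rewrite opprB addrC subrK gtr0_norm; lra.
apply/nbhs_ballP; exists (Num.min d d'); first by rewrite /= lt_min d0.
move=> s; rewrite /ball/= lt_min => /andP[tsd tsd'].
have lo : push t - e <= push s.
  by apply: le_trans dH' _; apply: push_mono; move: tsd'; rewrite ltr_norml; lra.
have hi : push s <= push t + e.
  apply: push_le; split; first by rewrite addr_ge0 ?push_ge0// ltW.
  move=> u us; have [ut|tu] := leP u t.
    apply: le_trans (_ : H u (push t) <= _); first exact: (push_feasible t).2.
    by apply: H_le; rewrite lerDl ltW.
  apply/ltW/dH; last by rewrite subrr normr0.
  by move: tsd; rewrite !ltr_norml; lra.
by rewrite ler_norml; lra.
Qed.

(** Near [t] the constraint holds strictly even at a level [a] below [push t]. Times just after [t]
    thus force nothing above [push t], and times just before force nothing above [a], so that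
    [push t] was already reached at [t - d / 2]. *)
Lemma push_flat t : 0 < H t (push t) ->
  exists2 d, 0 < d & push (t + d) = push (t - d).
Proof.
move=> /near_gt0[d d0 dH]; exists (d / 2); first by rewrite divr_gt0.
pose a := push t - d / 2.
have aH s : `|t - s| < d -> 0 < H s a.
  by move=> ts; apply: dH => //; rewrite /a opprB addrC subrK gtr0_norm; lra.
apply/eqP; rewrite eq_le; apply/andP; split; last by apply: push_mono; lra.
have H1 : push (t + d / 2) <= push t.
  apply: push_le; split; first exact: push_ge0.
  move=> s sd; have [st|ts] := leP s t; first exact: (push_feasible t).2.
  by apply/ltW/dH; rewrite ?subrr ?normr0// ltr_norml; lra.
have H2 : push t <= Num.max a (push (t - d / 2)).
  apply: push_le; split; first by rewrite le_max push_ge0 orbT.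
  move=> s st; have [sd|ds] := leP s (t - d / 2).
    apply: le_trans (_ : H s (push (t - d / 2)) <= _).
      exact: (push_feasible _).2.
    by apply: H_le; rewrite le_max lexx orbT.
  apply: le_trans (_ : H s a <= _); last by apply: H_le; rewrite le_max lexx.
  by apply/ltW/aH; rewrite ltr_norml; lra.
apply: le_trans H1 _; move: H2; rewrite le_max => /orP[|//].
by rewrite /a; lra.
Qed.

Definition push_I0 : I0 T := @MkI0 R T push
  (continuous_subspaceT push_continuous) (fun s t _ st _ => push_mono st) push0.

End deterministic_skorokhod.

(** * Lebesgue-Stieltjes integrals against a nondecreasing function *)

Section stieltjes.
Context (R : realType) (T : R).
Hypothesis T_gt0 : 0 < T.
Implicit Types (A : I0 T).

Lemma I0_eps A x e : 0 <= x <= T -> 0 < e -> exists2 d, 0 < d &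
  forall y, 0 <= y <= T -> `|x - y| < d -> `|A x - A y| < e.
Proof.
move=> xT e0.
have xI : `[0, T]%classic x by rewrite /= in_itv.
have /subspace_continuousP/(_ _ xI) := @I0_continuous R T A.
move=> /cvgrPdist_lt/(_ e e0)/nbhs_ballP[d /= d0 dA].
by exists d => // y yT xy; apply: (dA y).
Qed.

Lemma I0_ge0 A t : 0 <= t <= T -> 0 <= A t.
Proof.
by move=> /andP[t0 tT]; rewrite -{1}(I0_start A); apply: I0_nondecreasing.
Qed.

Lemma stieltjes_ocitv (f : cumulative R R) (a b : R) : a <= b ->
  lebesgue_stieltjes_measure f `]a, b]%classic = (f b - f a)%:E.
Proof.
move=> ab; rewrite /lebesgue_stieltjes_measure /measure_extension measurable_mu_extE/=; last exact: is_ocitv.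
by rewrite wlength_itv_bnd.
Qed.

(** Each [t] with [h t] positive lies in an interval with rational endpoints on which [stopped A]
    does not increase. There are countably many of these and each is null, so [h] vanishes off a
    null set. *)
Lemma stieltjes_integral_eq0 A (h : R -> \bar R) :
  (forall t, 0 <= t <= T -> (0 <= h t)%E) ->
  (forall t, 0 <= t <= T -> (0 < h t)%E ->
     exists2 d, 0 < d & stopped A (t + d) = stopped A (t - d)) ->
  (\int[lebesgue_stieltjes_measure (stopped A)]_(t in `[0%R, T]) h t = 0)%E.
Proof.
move=> h0 hflat; set mu := lebesgue_stieltjes_measure _.
pose F k : set R := if (unpickle k : option (rat * rat)) is Some pq then
  if (pq.1 <= pq.2) && (stopped A (ratr pq.2) == stopped A (ratr pq.1))
  then `]ratr pq.1, ratr pq.2]%classic else set0 else set0 : set R.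
have : mu.-negligible (\bigcup_k F k).
  apply: negligible_bigcup => k; rewrite /F.
  case: unpickle => [[p q]|]; last exact: negligible_set0.
  case: ifPn => [/andP[/= pq /eqP Apq]|_]; last exact: negligible_set0.
  apply/negligibleP; first exact: measurable_itv.
  apply: etrans (stieltjes_ocitv _ _) _; first by rewrite ler_rat.
  by rewrite /= Apq subrr.
move=> [N [mN N0 FN]].
rewrite integral_mkcond (eq_lower_integral_off (g := cst 0%E) mN N0); first exact: integral0.
move=> t Nt; rewrite patchE; case: ifPn => // /set_mem; rewrite /= in_itv/= => tT.
apply/eqP/negPn/negP => ht; apply: Nt; apply: FN.
have [|d d0 Ad] := hflat t tT; first by rewrite lt_neqAle eq_sym ht h0.
have td : t - d < t by lra.
have dt : t < t + d by lra.
have [p] := rat_in_itvoo td; rewrite in_itv/= => /andP[p1 p2].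
have [q] := rat_in_itvoo dt; rewrite in_itv/= => /andP[q1 q2].
have pq : p <= q by rewrite -(ler_rat R); exact: le_trans (ltW p2) (ltW q1).
have Apq : stopped A (ratr q) == stopped A (ratr p).
  apply/eqP/le_anti/andP; split; last by apply: stopped_nondecreasing; rewrite ler_rat.
  apply: le_trans (_ : stopped A (t + d) <= _).
    by apply: stopped_nondecreasing; exact: ltW.
  by rewrite Ad; apply: stopped_nondecreasing; exact: ltW.
have : `]ratr p, ratr q]%classic t by rewrite /= in_itv/= p2 ltW.
move: (pickleK (p, q)); move: (pickle _) => k kE tpq.
by exists k => //; rewrite /F kE/= pq Apq.
Qed.

(** The integral dominates [c] times the mass of []r', r]], which is the increment of [A]; the
    half-open interval is the one whose mass is computed directly. *)
Lemma stieltjes_integral_flat A (h : R -> \bar R) (r r' c : R) :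
  (forall t, 0 <= t <= T -> (0 <= h t)%E) ->
  (\int[lebesgue_stieltjes_measure (stopped A)]_(t in `[0%R, T]) h t = 0)%E ->
  0 < c -> 0 <= r' -> r' <= r -> r <= T ->
  (forall s, r' < s <= r -> (c%:E <= h s)%E) -> A r' = A r.
Proof.
move=> h0; set mu := lebesgue_stieltjes_measure _ => int0 c0 r'0 r'r rT ch.
have mI : measurable (`]r', r]%classic : set (measurableTypeR R)) by exact: measurable_itv.
have : (\int[mu]_(s in `]r', r]) (cst c%:E s) <= 0)%E.
  rewrite -int0 integral_mkcond [leRHS]integral_mkcond.
  apply: ge0_lower_integral_le => s; rewrite !patchE.
    by case: ifPn => // _; rewrite lee_fin ltW.
  case: ifPn => [/set_mem|_]; last first.
    by case: ifPn => // /set_mem; rewrite /= in_itv/=; exact: h0.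
  rewrite /= in_itv/= => sI; rewrite ifT; first exact: ch.
  by apply/mem_set; rewrite /= in_itv/=; case/andP: sI; lra.
rewrite (integral_cst _ mI) [X in (_ * X)%E](stieltjes_ocitv (stopped A) r'r).
rewrite -EFinM lee_fin pmulr_rle0// subr_le0 => Ar.
have {Ar} : stopped A r <= stopped A r' := Ar.
rewrite /stopped !clamp_id//; last 2 first.
- by lra.
- by lra.
move=> Ar; apply/eqP; rewrite eq_le Ar andbT.
exact: I0_nondecreasing.
Qed.

End stieltjes.

(** * Uniqueness for the deterministic problem *)

Section uniqueness.
Context (R : realType) (T : R).
Hypothesis T_gt0 : 0 < T.
Variable H : R -> R -> R.
Hypothesis H_continuous : forall t a e, 0 < e -> exists2 d, 0 < d &
  forall s b, `|t - s| < d -> `|a - b| < d -> `|H t a - H s b| < e.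
Hypothesis H_incr : forall t a b, a < b -> H t a < H t b.

Definition skorokhod_solution (A : I0 T) :=
  (forall t, 0 <= t <= T -> 0 <= H t (A t)) /\
  (\int[lebesgue_stieltjes_measure (stopped A)]_(t in `[0%R, T]) (H t (A t))%:E = 0)%E.

(** [E] collects the times up to [t] at which [A'] already has the value [A' t], and [r] is its
    infimum, attained by continuity. Constancy of [A'] just before [r] then contradicts minimality.
    Exchanging the two solutions gives equality. *)
Lemma skorokhod_solution_le (A A' : I0 T) t :
  skorokhod_solution A -> skorokhod_solution A' -> 0 <= t <= T -> A' t <= A t.
Proof.
move=> [HA _] [HA' intA'] tT; rewrite leNgt; apply/negP => AA'.
have /andP[t0 t1] := tT.
pose E := [set u | 0 <= u <= t /\ A' u = A' t].
have Et : E t by split; rewrite ?lexx ?t0.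
have hE : has_inf E by split; [exists t|exists 0 => u [/andP[]]].
set r := inf E.
have r_ge0 : 0 <= r by apply: lb_le_inf => [|u [/andP[]]//]; exists t.
have lbE u : E u -> r <= u by move=> Eu; apply: ge_inf => //; case: hE.
have r_le : r <= t by exact: lbE.
have rT : 0 <= r <= T by rewrite r_ge0 (le_trans r_le).
have Ar : A' r = A' t.
  apply/eqP; rewrite eq_le I0_nondecreasing//= leNgt; apply/negP => Art.
  have e0 : 0 < A' t - A' r by rewrite subr_gt0.
  have [d d0 dA] := I0_eps A' rT e0.
  have [u [/andP[u0 ut] Au] ur] := inf_adherent d0 hE.
  have ru : r <= u by apply: lbE; split => //; rewrite u0.
  have := dA u; rewrite u0 (le_trans ut t1) => /(_ isT).
  have ru' : `|r - u| < d by move: ur; rewrite -/r ltr_norml; lra.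
  by move=> /(_ ru'); rewrite Au distrC gtr0_norm// ltxx.
have Hr : 0 < H r (A' r).
  apply: le_lt_trans (HA _ rT) _; apply: H_incr.
  by rewrite Ar; apply: le_lt_trans AA'; apply: I0_nondecreasing.
(* Otherwise [A' t] would equal [A' 0 = 0], yet it exceeds the nonnegative [A t]. *)
have r_gt0 : 0 < r.
  rewrite lt_neqAle r_ge0 andbT; apply/eqP => r0.
  by move: AA'; rewrite -Ar -r0 I0_start ltNge I0_ge0.
have c0 : 0 < H r (A' r) / 2 by rewrite divr_gt0.
have [d1 d10 dH] := H_continuous r (A' r) c0.
have [d2 d20 dA] := I0_eps A' rT d10.
(* Close enough to [r] that $H(s,A'_s)$ is at least half of $H(r,A'_r)$ on []r', r]], and cut off at
   0. *)
pose r' := Num.max 0 (r - Num.min d1 d2 / 2).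
have m0 : 0 < Num.min d1 d2 by rewrite lt_min d10.
have m1 : Num.min d1 d2 <= d1 by rewrite ge_min lexx.
have m2 : Num.min d1 d2 <= d2 by rewrite ge_min lexx orbT.
have r'_ge0 : 0 <= r' by rewrite le_max lexx.
have r'_ge : r - Num.min d1 d2 / 2 <= r' by rewrite le_max lexx orbT.
have r'_lt : r' < r by rewrite gt_max r_gt0/=; lra.
have Ar' : A' r' = A' r.
  apply: (stieltjes_integral_flat _ intA' c0 r'_ge0 (ltW r'_lt)).
  - by move=> s sT; rewrite lee_fin HA'.
  - by case/andP: rT.
  - move=> s /andP[r's sr]; rewrite lee_fin.
    have rs : `|r - s| < Num.min d1 d2 by rewrite ltr_norml; lra.
    have sT : 0 <= s <= T by lra.
    have := dH s (A' s) (lt_le_trans rs m1) (dA s sT (lt_le_trans rs m2)).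
    by rewrite ltr_norml; lra.
have : r <= r' by apply: lbE; split; [lra|rewrite Ar' Ar].
by rewrite leNgt r'_lt.
Qed.

End uniqueness.

(** * Quasi-sure events *)

Section quasi_sure.
Context (R : realType) (T : R) (Ps : set (probability (Omega T) R)).
Hypothesis Ps0 : Ps !=set0.

(** Nonemptiness of [Ps] matters: over an empty family the supremum is [-oo], not 0. *)
Lemma qs_intro (N E : set (Omega T)) : measurable N ->
  (forall Q, Ps Q -> Q N = 0%E) -> ~` N `<=` E -> qs Ps E.
Proof.
move=> mN PN NE; exists N; split => //.
rewrite (_ : [set Q N | Q in Ps] = [set 0%E]) ?ereal_sup1//.
apply/seteqP; split => [_ [Q PQ <-]|_ ->]; first exact: PN.
by have [Q PQ] := Ps0; exists Q => //; exact: PN.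
Qed.

Lemma qs_all (E : set (Omega T)) : (forall w, E w) -> qs Ps E.
Proof.
by move=> hE; apply: (@qs_intro set0) => // w _; exact: hE.
Qed.

Lemma qsI (E F : set (Omega T)) : qs Ps E -> qs Ps F -> qs Ps (E `&` F).
Proof.
move=> /qs_null[N mN [PN NE]] /qs_null[M mM [PM MF]].
apply: (@qs_intro (N `|` M)); first exact: measurableU.
  by move=> Q PQ; apply: null_set_setU => //; [exact: PN|exact: PM].
by rewrite setCU => w [Nw Mw]; split; [exact: NE|exact: MF].
Qed.

Lemma qs_bigcap (E : nat -> set (Omega T)) :
  (forall k, qs Ps (E k)) -> qs Ps (\bigcap_k E k).
Proof.
move=> qE.
have /choice[N hN] : forall k, exists N : set (Omega T), [/\ measurable N,
    forall Q, Ps Q -> Q N = 0%E & ~` N `<=` E k].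
  by move=> k; have [N mN [PN NE]] := qs_null (qE k); exists N.
have mN : measurable (\bigcup_k N k).
  by apply: bigcup_measurable => k _; have [] := hN k.
apply: (qs_intro mN).
  move=> Q PQ; apply/(negligibleP _ mN); apply: negligible_bigcup => k.
  by have [mNk PN _] := hN k; apply/(negligibleP _ mNk); exact: PN.
rewrite setC_bigcup => w Nw k _; have [_ _] := hN k; apply; exact: Nw.
Qed.

End quasi_sure.

(** * Stability of $S_G^p$ under deterministic translations *)

Lemma powRD_le (R : realType) (a b p : R) : 1 <= p ->
  `|a + b| `^ p <= 2 `^ p * (`|a| `^ p + `|b| `^ p).
Proof.
move=> p1; have p0 : 0 <= p := le_trans ler01 p1.
have le2 : `|a + b| <= 2 * Num.max `|a| `|b|.
  apply: le_trans (ler_normD _ _) _; rewrite mulr_natl mulr2n.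
  by apply: lerD; rewrite le_max lexx ?orbT.
have m0 : 0 <= Num.max `|a| `|b| by rewrite le_max normr_ge0.
apply: le_trans (_ : (2 * Num.max `|a| `|b|) `^ p <= _).
  by apply: ge0_ler_powR => //; rewrite nnegrE// mulr_ge0.
rewrite powRM//; apply: ler_wpM2l; first exact: powR_ge0.
by case: (leP `|a| `|b|) => _; rewrite ?lerDl ?lerDr powR_ge0.
Qed.

Section translation.
Context (R : realType) (T : R) (Ps : set (probability (Omega T) R)).
Hypotheses (T_gt0 : 0 < T) (Ps0 : Ps !=set0).

Lemma stopped_continuous (A : I0 T) : continuous (stopped A).
Proof.
move=> t; apply/cvgrPdist_lt => e e0.
have [d d0 dA] := I0_eps A (clamp_in T_gt0 t) e0.
apply/nbhs_ballP; exists d => // s ts; apply: dA; first exact: clamp_in.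
exact: le_lt_trans (clamp_lip T_gt0 _ _) ts.
Qed.

(** Processes in [SG0] depend on time in a Lipschitz way, which [A] need not do; interpolation
    supplies a bounded Lipschitz substitute. *)
Lemma I0_approx (A : I0 T) (e : R) : 0 < e -> exists a : R -> R,
  [/\ exists M, forall t, `|a t| <= M,
      exists2 C, 0 <= C & forall s t, `|a s - a t| <= C * `|s - t| &
      forall t, 0 <= t <= T -> `|A t - a t| <= e].
Proof.
move=> e0; have frozen t : stopped A t = stopped A (clamp T t).
  by rewrite /stopped [clamp T (clamp T t)]clamp_id// clamp_in.
have [d d0 dA] := frozen_unif_continuous T_gt0 (@stopped_continuous A) frozen e0.
exists (interp (Num.trunc (T / d)).+1 (stopped A) 0 d); split.
- exact: interp_bounded.
- exact: interp_lip.
move=> t tT; have -> : A t = stopped A t by rewrite /stopped clamp_id.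
rewrite distrC; apply: interp_close => //; rewrite add0r.
case/andP: tT => -> tT /=; apply: le_trans tT _; rewrite -ler_pdivrMr//.
have Td : 0 <= T / d by rewrite divr_ge0// ltW.
by have /andP[_ /ltW] := trunc_itv Td.
Qed.

Lemma SG0D (eta : R -> Omega T -> R) (a : R -> R) : SG0 eta ->
  (exists M, forall t, `|a t| <= M) ->
  (exists2 C, 0 <= C & forall s t, `|a s - a t| <= C * `|s - t|) ->
  SG0 (fun t w => eta t w + a t).
Proof.
move=> [n [ts [f [ts_in [[M [_ fM]] [K [_ fK]]] etaE]]]] [M' aM] [C C0 aC].
(* The coordinate [lshift n ord0] of the argument of [f] is the time. *)
exists n, ts, (fun x => f x + a (x ord0 (lshift n ord0))); split => //.
  split.
    exists (M + 1 + M'); split; first exact: num_real.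
    move=> y My x _; apply: le_trans (ler_normD _ _) _; apply: le_trans (ltW My).
    by apply: lerD => //; apply: fM => //; rewrite ltrDl.
  exists (K + 1 + C); split; first exact: num_real.
  move=> y Ky [x1 x2] _ /=.
  rewrite opprD addrACA; apply: le_trans (ler_normD _ _) _.
  apply: le_trans (_ : (K + 1 + C) * `|x1 - x2| <= _); last first.
    by apply: ler_wpM2r => //; exact: ltW.
  rewrite mulrDl; apply: lerD.
    by apply: (fK (K + 1) _ (x1, x2)) => //; rewrite ltrDl.
  apply: le_trans (aC _ _) _; apply: ler_wpM2l => //.
  by have := entry_le_mx_norm (x1 - x2) ord0 (lshift n ord0); rewrite !mxE.
by move=> t w tT; rewrite etaE// row_mxEl mxE.
Qed.

Lemma SG_translate (p : R) (S : R -> Omega T -> R) (A : I0 T) : 1 <= p ->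
  SG Ps p S -> SG Ps p (fun t w => S t w + A t).
Proof.
move=> p1 [mS cS [eta_ eta0 cvg]]; have p0 : 0 < p := lt_le_trans ltr01 p1.
split.
- by move=> t tT; apply: measurable_funD => //; exact: mS.
- have [N [mN N0 NE]] := cS; exists N; split => // w /NE cw.
  by move=> x; apply: cvgD; [exact: cw|exact: I0_continuous].
have /choice[a_ aP] := fun k : nat => I0_approx A (e := k.+1%:R^-1) ltac:(by rewrite invr_gt0).
exists (fun k t w => eta_ k t w + a_ k t).
  by move=> k; have [aM aC _] := aP k; exact: SG0D.
apply: ge0_cvge0 => [k|e e0]; first exact: poweR_ge0.
have d0 : 0 < e / 8 by rewrite divr_gt0.
have d0' : (0 < (e / 8)%:E)%E by rewrite lte_fin.
apply: filterS2 (cvg_lt_ereal d0' cvg) (near_infty_natSinv_lt (PosNum d0)) => k /=.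
move=> Sk kd; have [_ _ Aa] := aP k.
pose g w := ereal_sup [set ((`|S t w - eta_ k t w| `^ p)%R)%:E | t in `[0%R, T]].
pose g' w := ereal_sup [set
  ((`|S t w + A t - (eta_ k t w + a_ k t)| `^ p)%R)%:E | t in `[0%R, T]].
have sup_ge0 (h : R -> R) :
    (0 <= ereal_sup [set ((`|h t| `^ p)%R)%:E | t in `[0%R, T]])%E.
  apply: le_trans (_ : ((`|h 0| `^ p)%:E <= _)%E); first by rewrite lee_fin powR_ge0.
  by apply: ereal_sup_ubound; exists 0 => //; rewrite /= in_itv/= lexx ltW.
have g0 w : (0 <= g w)%E by exact: (sup_ge0 (fun t => S t w - eta_ k t w)).
have g'0 w : (0 <= g' w)%E.
  exact: (sup_ge0 (fun t => S t w + A t - (eta_ k t w + a_ k t))).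
have Eg0 : (0 <= Ehat Ps g)%E.
  have [Q PQ] := Ps0; apply: le_trans (_ : (\int[Q]_w g w <= _)%E); first exact: integral_ge0.
  by apply: ereal_sup_ubound; exists Q.
have Eg : (Ehat Ps g < ((e / 8) `^ p)%:E)%E by exact: poweR_inv_lt.
have c0 : 0 <= (e / 8) `^ p by rewrite powR_ge0.
have two0 : 0 < (2 : R) `^ p by rewrite powR_gt0.
(* Two errors of size [e / 8], one from [S] and one from [A], give the bound
   [2 * 2 ^ p * (e / 8) ^ p], which is at most [(e / 2) ^ p] because [2 <= 2 ^ p]. *)
have Eg' : (Ehat Ps g' <= ((e / 2) `^ p)%:E)%E.
  apply: ge_ereal_sup => _ [Q PQ <-].
  apply: le_trans (_ : _ <= (2 `^ p)%:E * (\int[Q]_w g w + ((e / 8) `^ p)%:E))%E _.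
    apply: lower_integral_le_affine => // w.
    apply: ge_ereal_sup => _ [t tT <-].
    have tT' : 0 <= t <= T by move: tT; rewrite /= in_itv.
    apply: le_trans (_ : _ <= (2 `^ p)%:E *
        ((`|S t w - eta_ k t w| `^ p)%:E + ((e / 8) `^ p)%:E))%E _; last first.
      by rewrite lee_pmul2l// leeD2r//; apply: ereal_sup_ubound; exists t.
    rewrite -EFinD -EFinM lee_fin opprD addrACA.
    apply: le_trans (powRD_le _ _ p1) _; rewrite ler_pM2l// lerD2l.
    apply: ge0_ler_powR; rewrite ?nnegrE ?(ltW p0) ?(ltW d0)//.
    by apply: le_trans (Aa t tT') (ltW kd).
  apply: le_trans (_ : _ <= (2 `^ p)%:E * (((e / 8) `^ p)%:E + ((e / 8) `^ p)%:E))%E _.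
    rewrite lee_pmul2l// leeD2r//; apply: le_trans (ltW Eg).
    by apply: ereal_sup_ubound; exists Q.
  rewrite -EFinD -EFinM lee_fin.
  have -> : e / 2 = 2 * (2 * (e / 8)) by field.
  move: (e / 8) d0 => d d0; rewrite powRM ?mulr_ge0 ?(ltW d0)// ler_pM2l// powRM ?(ltW d0)//.
  have -> : d `^ p + d `^ p = 2 * d `^ p by ring.
  rewrite ler_wpM2r ?powR_ge0//.
  by rewrite -[leLHS]powRr1//; apply: ler_powR => //; rewrite ler1n.
have -> : SG_norm Ps p (fun t w => S t w + A t - (eta_ k t w + a_ k t)) =
  (Ehat Ps g' `^ p^-1)%E by [].
apply: le_lt_trans (_ : _ <= (((e / 2) `^ p)%:E `^ p^-1)%E)%E _; last first.
  rewrite poweR_EFin -powRrM divff ?gt_eqF// powRr1 ?divr_ge0 ?(ltW e0)//.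
  by rewrite lte_fin; lra.
apply: gt0_ler_poweR => //; first by rewrite invr_ge0 ltW.
- rewrite in_itv/= leey andbT.
  have [Q PQ] := Ps0; apply: le_trans (_ : (\int[Q]_w g' w <= _)%E); first exact: integral_ge0.
  by apply: ereal_sup_ubound; exists Q.
- by rewrite in_itv/= leey lee_fin powR_ge0.
Qed.

End translation.

(** * Existence and uniqueness for the mean-reflected problem *)

(** Over an empty family the constant 0 would have upper expectation [-oo], whereas the represented
    value is real. *)
Lemma represents_nonempty (R : realType) (T sigma_lo sigma_hi : R)
    (Ps : set (probability (Omega T) R)) : 0 < T ->
  represents_Gexpectation sigma_lo sigma_hi Ps -> Ps !=set0.
Proof.
move=> T0 repr; apply/set0P/eqP => Ps0.
have L0 : Lip (cst 0 : Omega T -> R).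
  exists 0%N, [tuple of [:: 0]], (cst 0); split => //.
    by move=> i; rewrite (tnth_nth 0) (ord1 i)/= lexx ltW.
  split; first by exists 0; split => // x x0 y _ /=; rewrite normr0; exact: ltW.
  exists 0; split => // x x0 y _ /=.
  by rewrite subrr normr0 mulr_ge0//; exact: ltW.
by have := repr _ L0; rewrite /Ehat Ps0 image_set0 ereal_sup0.
Qed.

Theorem theorem3p2 (R : realType) (T sigma_lo sigma_hi : R)
    (T_gt0 : 0 < T)
    (sigma_lo_gt0 : 0 < sigma_lo ^+ 2)
    (sigma_lt : sigma_lo ^+ 2 < sigma_hi ^+ 2)
    (Ps : set (probability (Omega T) R))
    (Ps_compact : weakly_compact Ps)
    (Ps_repr : represents_Gexpectation sigma_lo sigma_hi Ps)
    (l : Omega T -> R -> R -> R) (l_Hl : Hl Ps l)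
    (p : R) (S : R -> Omega T -> R) (S_HS : HS Ps l p S) :
  exists (X : R -> Omega T -> R) (A : I0 T),
    SP Ps l p S X A /\
    forall (X' : R -> Omega T -> R) (A' : I0 T), SP Ps l p S X' A' ->
      qs Ps [set w | forall t : R, 0 <= t <= T -> X' t w = X t w] /\
      (forall t : R, 0 <= t <= T -> A' t = A t).
Proof.
have Ps0 := represents_nonempty T_gt0 Ps_repr.
have [p1 S_SG _] := S_HS.
pose H := constraint Ps l S.
have H_cont t a e : 0 < e -> exists2 d, 0 < d &
    forall s b, `|t - s| < d -> `|a - b| < d -> `|H t a - H s b| < e.
  exact: (constraint_continuous T_gt0 Ps_compact Ps0 l_Hl S_HS).
have H_incr t a b : a < b -> H t a < H t b.
  exact: (constraint_incr T_gt0 Ps_compact Ps0 l_Hl S_HS).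
have H_frozen t a : H t a = H (clamp T t) a.
  by rewrite /H /constraint (clamp_id (clamp_in T_gt0 t)).
have H00 : 0 <= H 0 0 := constraint00 T_gt0 Ps_compact Ps0 l_Hl S_HS.
have H_pos t : exists a, 0 < H t a.
  exact: (constraint_pos T_gt0 Ps_compact Ps0 l_Hl S_HS).
have EH t a : 0 <= t <= T -> Ehat Ps (fun w => (l w t (S t w + a))%:E) = (H t a)%:E.
  move=> tT; have := constraint_qcont T_gt0 l_Hl S_HS t a.
  by move=> /(EhatE Ps_compact Ps0); rewrite /H /constraint clamp_id.
pose A := push_I0 T_gt0 H_cont H_incr H_frozen H00 H_pos.
pose X t w := S t w + A t.
have AE t : A t = push H t by [].
have HA t : 0 <= H t (A t) by exact: (constraint_push_ge0 T_gt0 H_cont H_incr H_frozen H_pos).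
have intA : (\int[lebesgue_stieltjes_measure (stopped A)]_(t in `[0%R, T]) (H t (A t))%:E = 0)%E.
  apply: (stieltjes_integral_eq0 (A := A)) => t tT; first by rewrite lee_fin.
  rewrite lte_fin => /(push_flat T_gt0 H_cont H_incr H_frozen H_pos)[d d0 flat].
  have mono := push_mono T_gt0 H_cont H_incr H_frozen H_pos.
  (* [push_flat] may look beyond [[0, T]], where [stopped A] is frozen; clamping only moves [t - d]
     and [t + d] towards [t], so flatness is inherited. *)
  have lo : t - d <= clamp T (t - d).
    have := clamp_lip T_gt0 (t - d) t; rewrite (clamp_id tT) ler_norml.
    by rewrite (_ : t - d - t = - d) ?normrN ?gtr0_norm//; lra.
  have hi : clamp T (t + d) <= t + d.
    have := clamp_lip T_gt0 (t + d) t; rewrite (clamp_id tT) ler_norml.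
    by rewrite (_ : t + d - t = d) ?gtr0_norm//; lra.
  exists d => //; apply/le_anti/andP; split; last first.
    by apply: stopped_nondecreasing; lra.
  apply: le_trans (mono _ _ hi) _; rewrite flat; exact: mono.
exists X, A; split.
  split.
  - exact: SG_translate.
  - by move=> t tT; exact: qs_all.
  - by move=> t tT; rewrite EH// lee_fin.
  - rewrite -[RHS]intA; apply: eq_integral => t; rewrite inE/= in_itv/= => tT.
    exact: EH.
move=> X' A' [X'_SG X'E X'_ge0 X'_int].
have EX' t : 0 <= t <= T -> Ehat Ps (fun w => (l w t (X' t w))%:E) = (H t (A' t))%:E.
  move=> tT; rewrite -EH//; congr ereal_sup; apply: eq_imagel => Q PQ.
  have [N mN [PN NE]] := qs_null (X'E t tT).
  by apply: (eq_lower_integral_off mN (PN Q PQ)) => w Nw; rewrite (NE w Nw).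
have solA : skorokhod_solution H A by [].
have solA' : skorokhod_solution H A'.
  split; first by move=> t tT; rewrite -lee_fin -EX'// X'_ge0.
  rewrite -[RHS]X'_int; apply: eq_integral => t; rewrite inE/= in_itv/= => tT.
  by rewrite EX'.
have A'A t : 0 <= t <= T -> A' t = A t.
  move=> tT; apply/le_anti/andP; split.
    exact: (skorokhod_solution_le H_cont H_incr solA solA').
  exact: (skorokhod_solution_le H_cont H_incr solA' solA).
split => //.
(* The identity X' = X holds q.s. at all rational times at once, hence at all
   times by continuity of the paths. *)
pose E k := [set w | if (unpickle k : option rat) is Some q
  then X' (clamp T (ratr q)) w = X (clamp T (ratr q)) w else True].
have qE k : qs Ps (E k).
  rewrite /E; case: unpickle => [q|]; last exact: qs_all.
  have cq := clamp_in T_gt0 (ratr q : R).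
  have [N [mN N0 NE]] := X'E _ cq; exists N; split => // w /NE /= ->.
  by rewrite A'A.
have [_ cX' _] := X'_SG; have [_ cS _] := S_SG.
have [N [mN N0 NE]] := qsI Ps0 (qsI Ps0 cX' cS) (qs_bigcap Ps0 qE).
exists N; split => // w /NE[[/= cX'w cSw] Ew] t tT.
apply/eqP/negPn/negP => X'X.
have cD : {within `[0, T], continuous (fun s => X' s w - X s w)}.
  move=> s; apply: cvgB; first exact: cX'w.
  by apply: cvgD; [exact: cSw|exact: I0_continuous].
have D0 : 0 < `|X' t w - X t w| by rewrite normr_gt0 subr_eq0.
have tI : `[0, T]%classic t by rewrite /= in_itv.
have /subspace_continuousP/(_ _ tI)/cvgrPdist_lt/(_ _ D0) := cD.
move=> /nbhs_ballP[d /= d0 dD].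
(* The rational may exceed [T]; clamping brings it back without moving it away from [t]. *)
have td : t < t + d by lra.
have [q] := rat_in_itvoo td; rewrite in_itv/= => /andP[tq qd].
have tq' : `|t - clamp T (ratr q)| < d.
  rewrite -{1}(clamp_id tT); apply: le_lt_trans (clamp_lip T_gt0 _ _) _.
  by rewrite ltr_norml; lra.
have qI : `[0, T]%classic (clamp T (ratr q)) by rewrite /= in_itv/= clamp_in.
have lt_D : `|X' t w - X t w -
    (X' (clamp T (ratr q)) w - X (clamp T (ratr q)) w)| < `|X' t w - X t w|.
  exact: dD _ tq' qI.
have Xq : X' (clamp T (ratr q)) w = X (clamp T (ratr q)) w.
  move: Ew; move: (pickleK q); move: (pickle q) => k kE /(_ k I).
  by rewrite /E/= kE.
by rewrite Xq subrr subr0 ltxx in lt_D.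
Qed.
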